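(* Let $p\ge 3$ be a prime and let $L$ be a soluble $3$-dimensional $\mathbb{Z}_p$-Lie algebra associated to one of the families D, E, F, G described in the context. Then, for suitable $k,\iota\in\mathbb{N}_0$ and $*=\square$ or $*=\not\square$, $$\zeta_{L}(s)=\zeta_{\mathbb{Z}_p^3}(s)-Z_{*,k}(s-2)\,\zeta_p(2s-2)\,\zeta_p(s-2)\,p^{(2-s)(\iota+1)}(1-p^{-1})^{-1}.$$ The abscissa of convergence $\alpha$ of $\zeta_{L}(s)$ equals $1$ in all cases. If $*=\square$ and $k$ is even, then $\zeta_{L}(s)$ has a triple pole at $s=1$. In all other cases $\zeta_{L}(s)$ has a double pole at $s=1$.
   Context: $\mathbb{Z}_p$ is the ring of $p$-adic integers, $\mathbb{Z}_p^*$ its group of units, $\mathbb{N}=\{1,2,\dots\}$, $\mathbb{N}_0=\mathbb{N}\cup\{0\}$. For a $\mathbb{Z}_p$-algebra $L$ additively isomorphic to $\mathbb{Z}_p^n$, $\zeta_L(s)=\sum_{H\le L}|L:H|^{-s}$, where the sum ranges over the subalgebras $H$ of finite index in $L$ and $s$ is a complex variable. Put $\zeta_p(s)=(1-p^{-s})^{-1}$ and $\zeta_{\mathbb{Z}_p^3}(s)=\zeta_p(s)\zeta_p(s-1)\zeta_p(s-2)$, the zeta function of the abelian $3$-dimensional $\mathbb{Z}_p$-Lie algebra. Identities are identities of rational functions in $p^{-s}$, and poles refer to the meromorphic continuation. For $f\in\mathbb{Z}_p[x_1,\dots,x_n]$, Igusa's local zeta function is $Z_f(s)=\int_{\mathbb{Z}_p^n}|f(\mathbf{x})|_p^s\,d\mu$,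 with $|\cdot|_p$ the $p$-adic absolute value and $\mu$ the normalised additive Haar measure. For $k\in\mathbb{N}_0$ and $f(x_2,x_3)=x_2^2-\delta x_3^2$ with $\delta\in\mathbb{Z}_p$, set: $Z_{\not\square,k}(s):=Z_f(s)$ if $\delta=p^k\rho$ with $\rho\in\mathbb{Z}_p^*$ a non-square modulo $p$; and $Z_{\square,k}(s):=Z_f(s)$ if $\delta=p^ku^2$ with $u\in\mathbb{Z}_p^*$. The families are as follows; each Lie algebra has a $\mathbb{Z}_p$-basis $(e_1,e_2,e_3)$ with $[e_2,e_3]=0$. Family D: $L_2(0,r,d)$, $r\in\mathbb{N}$, $d\in\mathbb{Z}_p$: $[e_1,e_2]=-e_2-p^rd\,e_3$, $[e_1,e_3]=-p^re_2-e_3$. Family E: $L_3(0,r,d)$, $r\in\mathbb{N}_0$, $d\in\mathbb{Z}_p$: $[e_1,e_2]=-d\,e_3$, $[e_1,e_3]=-e_2-p^re_3$. Family F: $L_4(0,r)$, $r\in\mathbb{N}_0$: $[e_1,e_2]=-p^re_3$, $[e_1,e_3]=-e_2$. Family G: $L_5(0,r)$, $r\in\mathbb{N}_0$: $[e_1,e_2]=-p^r\rho\,e_3$, $[e_1,e_3]=-e_2$, where $\rho\in\mathbb{Z}_p^*$ is a non-square modulo $p$. These Lie algebras are maximal representatives of homothety classes; $L$ is associated to one of the families if it is isomorphic to $p^iL_0$ for some $i\in\mathbb{N}_0$ and some $L_0$ in that family, where $p^iL_0$ has the structure constants of $L_0$ multiplied by $p^i$.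
   Formalization: The formal theorem additionally assumes d ≠ 0 in family D and p^(2r)+4d ≠ 0 in family E; in the excluded cases the claim is false, since the abscissa of convergence is then 3/2 and no finite k is suitable. *)

(* Defs.v *)
From HB Require Import structures.
From mathcomp Require Import all_boot all_order all_algebra finmap complex.
From mathcomp Require Import all_classical all_reals all_analysis.
From mathcomp.analysis.showcase Require Import summability.

Set Implicit Arguments.
Unset Strict Implicit.
Unset Printing Implicit Defensive.

Import Order.TTheory GRing.Theory Num.Theory.
Import numFieldNormedType.Exports.

Local Open Scope classical_set_scope.
Local Open Scope ring_scope.

(* The type [padic_int p] is the inverse limit of the rings Z / p ^ n.+1; the
   n-th component of an element is its residue modulo p ^ n.+1 (indexing starts
   at exponent 1 because 'Z_1 is not the zero ring in MathComp). *)
Record padic_int (p : nat) := PadicInt {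
  padic_seq :> forall n, 'Z_(p ^ n.+1);
  padic_coherent : forall n, padic_seq n = (padic_seq n.+1 : nat)%:R }.

HB.instance Definition _ p := gen_eqMixin (padic_int p).
HB.instance Definition _ p := gen_choiceMixin (padic_int p).

Section PadicRing.
Variable p : nat.
Implicit Types x y z : padic_int p.

Lemma padic_eqP x y : (forall n, x n = y n) -> x = y.
Proof.
case: x y => [x hx] [y hy] /= exy.
have e : x = y by apply: functional_extensionality_dep.
by subst y; congr PadicInt; exact: Prop_irrelevance.
Qed.

Lemma padic_mod_dvd n :
  ((Zp_trunc (p ^ n.+1)).+2 %| (Zp_trunc (p ^ n.+2)).+2)%N.
Proof.
case: (ltnP 1 p) => p1.
  have h m : (Zp_trunc (p ^ m.+1)).+2 = (p ^ m.+1)%N.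
    by apply: Zp_cast; rewrite -(exp1n m.+1) ltn_exp2r.
  by rewrite !h; exact: dvdn_exp2l.
by case: p p1 => [|[|//]] _; rewrite ?exp0n ?exp1n.
Qed.

Lemma padic_natr_mod n m :
  ((m %% (Zp_trunc (p ^ n.+2)).+2)%N)%:R = m%:R :> 'Z_(p ^ n.+1).
Proof.
have e k : (k%:R : 'Z_(p ^ n.+1)) = inZp k by rewrite -Zp_nat.
by rewrite !e; apply: val_inj; rewrite /= modn_dvdm ?padic_mod_dvd.
Qed.

Fact padic_zero_coh n :
  (fun m => 0 : 'Z_(p ^ m.+1)) n = (nat_of_ord (0%R : 'Z_(p ^ n.+2)))%:R.
Proof. by []. Qed.

Fact padic_one_coh n :
  (fun m => 1 : 'Z_(p ^ m.+1)) n = (nat_of_ord (1%R : 'Z_(p ^ n.+2)))%:R.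
Proof. by []. Qed.

Fact padic_add_coh x y n : x n + y n = (nat_of_ord (x n.+1 + y n.+1)%R)%:R.
Proof. by rewrite /= padic_natr_mod natrD -!padic_coherent. Qed.

Fact padic_mul_coh x y n : x n * y n = (nat_of_ord (x n.+1 * y n.+1)%R)%:R.
Proof. by rewrite /= padic_natr_mod natrM -!padic_coherent. Qed.

Fact padic_opp_coh x n : - x n = (nat_of_ord (- x n.+1)%R)%:R.
Proof.
have := congr1 (fun u : 'Z_(p ^ n.+2) => (nat_of_ord u)%:R : 'Z_(p ^ n.+1))
  (addNr (x n.+1)).
rewrite [in LHS]/= padic_natr_mod natrD -padic_coherent => /eqP.
by rewrite [eqbRHS]/= addr_eq0 => /eqP ->.
Qed.

Definition padic_zero := PadicInt padic_zero_coh.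
Definition padic_one := PadicInt padic_one_coh.
Definition padic_add x y := PadicInt (padic_add_coh x y).
Definition padic_mul x y := PadicInt (padic_mul_coh x y).
Definition padic_opp x := PadicInt (padic_opp_coh x).

Fact padic_addA : associative padic_add.
Proof. by move=> x y z; apply: padic_eqP => n; exact: addrA. Qed.
Fact padic_addC : commutative padic_add.
Proof. by move=> x y; apply: padic_eqP => n; exact: addrC. Qed.
Fact padic_add0 : left_id padic_zero padic_add.
Proof. by move=> x; apply: padic_eqP => n; exact: add0r. Qed.
Fact padic_addN : left_inverse padic_zero padic_opp padic_add.
Proof. by move=> x; apply: padic_eqP => n; exact: addNr. Qed.
Fact padic_mulA : associative padic_mul.
Proof. by move=> x y z; apply: padic_eqP => n; exact: mulrA. Qed.
Fact padic_mulC : commutative padic_mul.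
Proof. by move=> x y; apply: padic_eqP => n; exact: mulrC. Qed.
Fact padic_mul1 : left_id padic_one padic_mul.
Proof. by move=> x; apply: padic_eqP => n; exact: mul1r. Qed.
Fact padic_mulDl : left_distributive padic_mul padic_add.
Proof. by move=> x y z; apply: padic_eqP => n; exact: mulrDl. Qed.
Fact padic_one_neq0 : padic_one != padic_zero.
Proof. by apply/eqP => /(congr1 (fun x : padic_int p => val (x 0))). Qed.

HB.instance Definition _ := GRing.isZmodule.Build (padic_int p)
  padic_addA padic_addC padic_add0 padic_addN.
HB.instance Definition _ := GRing.Zmodule_isComNzRing.Build (padic_int p)
  padic_mulA padic_mulC padic_mul1 padic_mulDl padic_one_neq0.

Definition padic_unit x : bool := `[< exists y, y * x = 1 >].
Definition padic_inv x : padic_int p :=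
  if pselect (exists y, y * x = 1) is left h then projT1 (cid h) else x.

Fact padic_mulV : {in padic_unit, left_inverse 1 padic_inv *%R}.
Proof.
move=> x /asboolP ux; rewrite /padic_inv; case: pselect => // h.
by case: (cid h).
Qed.
Fact padic_unitP x y : y * x = 1 -> padic_unit x.
Proof. by move=> yx; apply/asboolP; exists y. Qed.
Fact padic_inv_out : {in [predC padic_unit], padic_inv =1 id}.
Proof. by move=> x /asboolP ux; rewrite /padic_inv; case: pselect. Qed.

HB.instance Definition _ := GRing.ComNzRing_hasMulInverse.Build (padic_int p)
  padic_mulV padic_unitP padic_inv_out.

Definition padic_open (A : set (padic_int p)) :=
  forall x, A x -> exists n, forall y, y n = x n -> A y.

Lemma padic_congr_le x y m n : (m <= n)%N -> x n = y n -> x m = y m.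
Proof.
move=> /subnK <-; elim: (n - m)%N => // k IH; rewrite addSn => e; apply: IH.
by rewrite (padic_coherent x) (padic_coherent y) e.
Qed.

Fact padic_openT : padic_open setT.
Proof. by move=> x _; exists 0%N. Qed.
Fact padic_openI : setI_closed padic_open.
Proof.
move=> A B oA oB x [/oA[m Am] /oB[n Bn]]; exists (maxn m n) => y yx.
by split; [apply: Am | apply: Bn]; apply: padic_congr_le yx;
  rewrite ?leq_maxl ?leq_maxr.
Qed.
Fact padic_open_bigU (I : Type) (f : I -> set (padic_int p)) :
  (forall i, padic_open (f i)) -> padic_open (\bigcup_i f i).
Proof.
move=> of_ x [i _ fix_]; have [n fn] := of_ i x fix_.
by exists n => y yx; exists i => //; exact: fn.
Qed.

HB.instance Definition _ := isOpenTopological.Build (padic_int p)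
  padic_openT padic_openI padic_open_bigU.
HB.instance Definition _ := isPointed.Build (padic_int p) 0.

Lemma padic_neq0 x : x != 0 -> exists n, x n != 0.
Proof.
move=> x0; apply: contrapT => /forallNP h; move/eqP: x0; apply.
by apply: padic_eqP => n; apply/eqP; apply: contrapT => /negP; exact: h.
Qed.

(* If n is minimal with x <> 0 mod p ^ n.+1 then the valuation of x is n. *)
Definition padic_abs (R : realType) x : R :=
  if pselect (exists n, x n != 0) is left h then p%:R ^- ex_minn h else 0.

Definition nonsquare_mod x := ~ exists y z : padic_int p, x = y ^+ 2 + p%:R * z.

End PadicRing.

Section Complex.
Variable R : realType.

(* R[i] as a MathComp-Analysis normed field. *)
Definition Cplx : numClosedFieldType := R[i].

Definition cpow (x : R) (s : Cplx) : Cplx :=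
  if x == 0 then 0 else
  let r := expR (complex.Re s * ln x) in let theta := complex.Im s * ln x in
  (r * cos theta +i* (r * sin theta))%C.

Definition zetap (p : nat) (s : Cplx) : Cplx := (1 - cpow p%:R (- s))^-1.

Definition zeta_regular (p : nat) (s : Cplx) : Prop := cpow p%:R (- s) != 1.

Definition zeta_abelian3 (p : nat) (s : Cplx) : Cplx :=
  zetap p s * zetap p (s - 1) * zetap p (s - 2%:R).

(* A pair (N, D) stands for the function N(p^-s) / D(p^-s) of s. *)
Definition ratfun := ({poly Cplx} * {poly Cplx})%type.

Definition ratfun_at (p : nat) (W : ratfun) (s : Cplx) : Cplx :=
  W.1.[cpow p%:R (- s)] / W.2.[cpow p%:R (- s)].

Definition ratfun_regular (p : nat) (W : ratfun) (s : Cplx) : Prop :=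
  W.2.[cpow p%:R (- s)] != 0.

Definition continuation (p : nat) (F : Cplx -> Cplx) (sigma : R) (W : ratfun) :=
  W.2 != 0 /\ forall s : Cplx, sigma < complex.Re s ->
    ratfun_regular p W s /\ F s = ratfun_at p W s.

Definition pole_of_order (F : Cplx -> Cplx) (s0 : Cplx) (m : nat) : Prop :=
  exists2 c : Cplx, c != 0 & (fun s => (s - s0) ^+ m * F s) @ s0^' --> c.

End Complex.

Section LieAlgebras.
Variables (K : comNzRingType) (L : lmodType K) (br : L -> L -> L).

Definition lie_bracket : Prop :=
  [/\ forall x, linear (br x), forall y, linear (br^~ y),
      forall x, br x x = 0 &
      forall x y z, br x (br y z) + br y (br z x) + br z (br x y) = 0].

Definition free_of_rank (n : nat) : Prop :=
  exists b : 'I_n -> L, bijective (fun c : 'rV[K]_n => \sum_i c 0 i *: b i).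

Definition submodule (M : set L) : Prop :=
  M 0 /\ forall a x y, M x -> M y -> M (a *: x + y).

Definition subalgebra (H : set L) : Prop :=
  submodule H /\ forall x y, H x -> H y -> H (br x y).

Definition derived (S : set L) : set L :=
  [set z | forall M : set L, submodule M ->
     (forall x y, S x -> S y -> M (br x y)) -> M z].

Definition soluble : Prop := exists n, iter n derived setT = [set 0].

Definition cosets (H : set L) : set (set L) :=
  [set [set y | H (y - x)] | x in setT].

Definition finite_index (H : set L) : Prop := finite_set (cosets H).

Definition sub_index (H : set L) : nat := #|` fset_set (cosets H)|.

Variable R : realType.

(* The subalgebras of finite index with their terms |L:H|^-s, extended by 0 to
   all subsets of L; sums are unconditional (limits over finite subfamilies). *)
Definition zeta_term (s : Cplx R) : set L -> Cplx R :=
  (fun H => cpow (sub_index H)%:R (- s))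
    \_ [set H | subalgebra H /\ finite_index H].

Definition zeta_cvg (s : Cplx R) : Prop :=
  cvg (partial_sum (zeta_term s) @ totally).

Definition zeta (s : Cplx R) : Cplx R := sum (zeta_term s).

Definition zeta_abscissa (alpha : R) : Prop :=
  forall s : Cplx R, (alpha < complex.Re s -> zeta_cvg s) /\
                     (complex.Re s < alpha -> ~ zeta_cvg s).

End LieAlgebras.

Definition lie_isomorphic (K : comNzRingType) (L M : lmodType K)
    (brL : L -> L -> L) (brM : M -> M -> M) : Prop :=
  exists f : {linear L -> M},
    bijective f /\ forall x y, f (brL x y) = brM (f x) (f y).

Section Igusa.
Variables (p n : nat).
Local Notation V := 'rV[padic_int p]_n.

Definition borel_space := g_sigma_algebraType (@open V).

Variables (R : realType) (mu : {measure set borel_space -> \bar R}).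

Definition normalised_haar : Prop :=
  mu setT = 1%E /\
  forall (a : V) (A : set borel_space), measurable A ->
    mu ((fun x : V => a + x) @` A) = mu A.

Definition igusa (f : V -> padic_int p) (s : Cplx R) : Cplx R :=
  let F x := cpow (padic_abs R (f x)) s in
  (Rintegral mu setT (fun x => complex.Re (F x))
    +i* Rintegral mu setT (fun x => complex.Im (F x)))%C.

End Igusa.

Section Families.
Variable p : nat.
Local Notation Zp := (padic_int p).
Local Notation V := 'rV[Zp]_3.

Definition binary_form (delta : Zp) (x : 'rV[Zp]_2) : Zp :=
  x 0 0 ^+ 2 - delta * x 0 1 ^+ 2.

(* [delta_class true k] and [delta_class false k] are the classes of delta
   defining Z_{square,k} and Z_{nonsquare,k}. *)
Definition delta_class (sq : bool) (k : nat) (delta : Zp) : Prop :=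
  if sq then exists2 u, u \is a GRing.unit & delta = p%:R ^+ k * u ^+ 2
  else exists rho, [/\ rho \is a GRing.unit, nonsquare_mod rho &
                       delta = p%:R ^+ k * rho].

Inductive lie_family : Type :=
  | FamD of nat & Zp
  | FamE of nat & Zp
  | FamF of nat
  | FamG of nat & Zp.

Definition family_ok (F : lie_family) : Prop :=
  match F with
  | FamD r _ => (0 < r)%N
  | FamG _ rho => rho \is a GRing.unit /\ nonsquare_mod rho
  | _ => True
  end.

Definition e2 : V := delta_mx 0 1.
Definition e3 : V := delta_mx 0 2%:R.

(* [family_ad F] is the pair ([e1, e2], [e1, e3]). *)
Definition family_ad (F : lie_family) : V * V :=
  match F with
  | FamD r d => (- e2 - (p%:R ^+ r * d) *: e3, - p%:R ^+ r *: e2 - e3)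
  | FamE r d => (- d *: e3, - e2 - p%:R ^+ r *: e3)
  | FamF r => (- p%:R ^+ r *: e3, - e2)
  | FamG r rho => (- (p%:R ^+ r * rho) *: e3, - e2)
  end.

(* The alternating bilinear extension of [family_ad F] with [e2, e3] = 0. *)
Definition family_bracket (F : lie_family) (x y : V) : V :=
  let: (u, v) := family_ad F in
  (x 0 0 * y 0 1 - x 0 1 * y 0 0) *: u +
  (x 0 0 * y 0 2%:R - x 0 2%:R * y 0 0) *: v.

Definition scaled_bracket (i : nat) (F : lie_family) (x y : V) : V :=
  p%:R ^+ i *: family_bracket F x y.

(* The discriminant tr^2 - 4 det of ad e1 acting on the span of e2 and e3. It
   is 4 p^(2r) d for D, p^(2r) + 4 d for E, 4 p^r for F and 4 p^r rho for G.
   When it vanishes, the binary form attached to the algebra is a multiple of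
   the square of a linear form: it has delta = 0, which is in no class
   [delta_class sq k], and the zeta function has abscissa 3/2. *)
Definition family_disc (F : lie_family) : Zp :=
  let: (u, v) := family_ad F in
  (u 0 1 + v 0 2%:R) ^+ 2 - 4%:R * (u 0 1 * v 0 2%:R - u 0 2%:R * v 0 1).

End Families.

(* Main.v *)
Require Import Defs.
From mathcomp Require Import all_boot all_order all_algebra finmap complex.
From mathcomp Require Import all_classical all_reals all_analysis.
From mathcomp Require Import ring lra zify.
From mathcomp.analysis.showcase Require Import summability.

Set Implicit Arguments.
Unset Strict Implicit.
Unset Printing Implicit Defensive.

Import Order.TTheory GRing.Theory Num.Theory.
Import numFieldNormedType.Exports.
Import Normc.

(** Completing the square in the form [x /\ (ad e1) x] on the abelian ideal
    spanned by [e2] and [e3] brings all four families to one shape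
    ([family_coordinates]): [ad e1] acts on the ideal as a scalar plus a unit times
    [p ^ iota] times a square root of some [delta], and the discriminant
    hypothesis says that [delta] is nonzero. The class of [delta] then provides
    [k] and the square or nonsquare type ([delta_class_exists]).

    A subalgebra of finite index is determined by its image [p ^ a] in the quotient
    by the ideal, by its intersection with the ideal, which is a lattice, and by a
    lift of [p ^ a *: e1] modulo that lattice. Written as a Hermite normal form, it
    is closed under the bracket exactly when [p ^ (a + iota)] times the square root
    of [delta] preserves the lattice ([hnf_subalgebra]). A lattice is [p ^ j] times
    one with cyclic quotient, and the latter is a point of a projective line modulo
    [p ^ n]; it is stable when the form [x2 ^ 2 - delta * x3 ^ 2] vanishes there
    modulo [p ^ (n - a - iota)]. So the number of subalgebras of given index is
    governed by the numbers of square roots of [delta] modulo powers of [p]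
    ([roots_small] and [roots_large]), through two recurrences of step 2
    ([algebra_countSS] and [prim_algebra_countSS]), which sum the zeta function to
    [zeta_value], on the half-plane where the real part of [s] exceeds 1
    ([zetaE]). On its left the algebra has too many subalgebras of each index
    [p ^ (2 * N)] ([zeta_diverges]).

    Igusa's integral depends on the same numbers: the set where [p ^ j] divides the
    form has a mass given by counting solutions modulo [p ^ j], and separating the
    primitive vectors yields again a recurrence of step 2 ([solutionsS]), with sum
    [igusa_value] ([igusaE]). Both values are rational in [t = p ^ (- s)] and in the
    generating function of the numbers of square roots, taken at the same point
    [p * t] after the shift by 2, and the identity is one between rational
    functions ([zeta_igusa_identity]).

    At [t = 1 / p] the factor [(1 - p ^ 2 * t ^ 2) ^ 2] gives a double pole, with a
    numerator that is a sum of positive terms. The generating function itself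
    contributes one more pole exactly when [delta] has square roots modulo all
    powers of [p], that is when it is a square of even valuation
    ([zeta_pole]). *)

Local Open Scope classical_set_scope.
Local Open Scope ring_scope.

(** * Arithmetic of p-adic integers *)
Section PadicArithmetic.
Variable p : nat.
Hypothesis p_pr : prime p.
Local Notation Zp := (padic_int p).
Implicit Types (x y z u : Zp) (m n k : nat).

(** Divisibility by [p ^ n] carries all the information on residues and
    valuations used below; unlike the component of index [n], it also makes sense
    and is uniform at the exponent 0. *)
Definition pdvd n x : bool := `[< exists y, x = p%:R ^+ n * y >].

Lemma pdvdP n x : reflect (exists y, x = p%:R ^+ n * y) (pdvd n x).
Proof. exact: asboolP. Qed.

Lemma pexp_gt1 n : (1 < p ^ n.+1)%N.
Proof. by rewrite -(exp1n n.+1) ltn_exp2r // prime_gt1. Qed.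

Lemma pexp_gt0 n : (0 < p ^ n)%N.
Proof. by rewrite expn_gt0 prime_gt0. Qed.

Lemma Zp_trunc_exp n : (Zp_trunc (p ^ n.+1)).+2 = (p ^ n.+1)%N.
Proof. exact/Zp_cast/pexp_gt1. Qed.

Lemma padic_natE k n : (k%:R : Zp) n = k%:R.
Proof. by elim: k => // k IH; rewrite !mulrS -IH. Qed.

Lemma Zp_nat_eq n (k l : nat) :
  (k%:R == l%:R :> 'Z_(p ^ n.+1)) = (k == l %[mod p ^ n.+1]).
Proof. by rewrite -val_eqE /= !val_Zp_nat ?pexp_gt1. Qed.

Lemma padic_val_lt x n : (x n < p ^ n.+1)%N.
Proof. by have := ltn_ord (x n); rewrite [X in (_ < X)%N -> _]Zp_trunc_exp. Qed.

Lemma padic_val_mod x m n : (m <= n)%N -> (x m = x n %% p ^ m.+1 :> nat)%N.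
Proof.
move=> /subnK <-; elim: (n - m)%N => [|k IH].
  by rewrite add0n modn_small // padic_val_lt.
rewrite addSn IH (padic_coherent x) val_Zp_nat ?pexp_gt1 //.
by rewrite modn_dvdm // dvdn_exp2l // ltnS leq_addl.
Qed.

(** The components of [x] are residues modulo [p ^ n.+1], so that exactly the
    multiples of [p ^ n.+1] vanish there; the quotient is read off from the
    higher components of [x]. *)
Lemma pdvdS n x : pdvd n.+1 x = (x n == 0).
Proof.
apply/pdvdP/eqP => [[y ->]|xn0].
  rewrite -natrX; have -> : ((p ^ n.+1)%:R * y) n = (p ^ n.+1)%:R * y n.
    by rewrite -padic_natE.
  have -> : (p ^ n.+1)%:R = 0%:R :> 'Z_(p ^ n.+1).
    by apply/eqP; rewrite Zp_nat_eq mod0n modnn.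
  by rewrite mul0r.
have dv m : (p ^ n.+1 %| x (m + n.+1))%N.
  have /(congr1 val) := xn0; rewrite /= (padic_val_mod x (m := n) (n := m + n.+1)) //.
    by move/eqP.
  by rewrite addnS ltnW // ltnS leq_addl.
pose s m : 'Z_(p ^ m.+1) := (x (m + n.+1) %/ p ^ n.+1)%:R.
have vs m : s m = (x (m + n.+1) %/ p ^ n.+1)%N :> nat.
  rewrite val_Zp_nat ?pexp_gt1 // modn_small // ltn_divLR ?pexp_gt0 //.
  by rewrite -expnD addSn; exact: padic_val_lt.
have cs m : s m = (s m.+1 : nat)%:R.
  apply/eqP; rewrite vs Zp_nat_eq.
  rewrite (padic_val_mod x (leqnSn (m + n.+1))) addSn.
  set X := nat_of_ord _; have [q ->] : exists q, X = (q * p ^ n.+1)%N.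
    by apply/dvdnP; apply: (dv m.+1).
  by rewrite -addSn expnD -muln_modl !mulnK ?pexp_gt0 // modn_mod.
exists (PadicInt cs); apply: padic_eqP => m.
rewrite -natrX; have -> : ((p ^ n.+1)%:R * PadicInt cs) m = (p ^ n.+1)%:R * s m.
  by rewrite -padic_natE.
rewrite -natrM mulnC divnK //; apply: val_inj.
by rewrite /= val_Zp_nat ?pexp_gt1 // -padic_val_mod // leq_addr.
Qed.

Lemma pdvd0 x : pdvd 0 x.
Proof. by apply/pdvdP; exists x; rewrite mul1r. Qed.

Lemma pdvdn0 n : pdvd n 0.
Proof. by apply/pdvdP; exists 0; rewrite mulr0. Qed.

Lemma pdvdD n x y : pdvd n x -> pdvd n y -> pdvd n (x + y).
Proof.
by move=> /pdvdP[u ->] /pdvdP[v ->]; apply/pdvdP; exists (u + v); rewrite mulrDr.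
Qed.

Lemma pdvdMl n x y : pdvd n x -> pdvd n (y * x).
Proof. by move=> /pdvdP[u ->]; apply/pdvdP; exists (y * u); rewrite mulrCA. Qed.

Lemma pdvdMr n x y : pdvd n x -> pdvd n (x * y).
Proof. by rewrite mulrC; exact: pdvdMl. Qed.

Lemma pdvdN n x : pdvd n (- x) = pdvd n x.
Proof. by apply/idP/idP => /(pdvdMl (-1)); rewrite mulN1r ?opprK. Qed.

Lemma pdvdBC n x y : pdvd n (x - y) = pdvd n (y - x).
Proof. by rewrite -opprB pdvdN. Qed.

Lemma pdvdDl n x y : pdvd n x -> pdvd n (x + y) = pdvd n y.
Proof.
move=> dx; apply/idP/idP => [h|]; last exact: pdvdD.
by rewrite -(addKr x y) pdvdD ?pdvdN.
Qed.

Lemma pdvd_congr n x y : pdvd n (x - y) -> pdvd n x = pdvd n y.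
Proof. by move=> h; rewrite -[x](subrK y) pdvdDl. Qed.

Lemma pdvd_le m n x : (m <= n)%N -> pdvd n x -> pdvd m x.
Proof.
move=> /subnKC <- /pdvdP[y ->]; apply/pdvdP; exists (p%:R ^+ (n - m) * y).
by rewrite exprD mulrA.
Qed.

Lemma pdvd_exp m n : (m <= n)%N -> pdvd m (p%:R ^+ n).
Proof. by move=> h; apply: (pdvd_le h); apply/pdvdP; exists 1; rewrite mulr1. Qed.

Lemma pdvdMexp m n x : pdvd n x -> pdvd (m + n) (p%:R ^+ m * x).
Proof. by move=> /pdvdP[y ->]; apply/pdvdP; exists y; rewrite exprD mulrA. Qed.

Lemma pdvd_nat n k : pdvd n (k%:R) = (p ^ n %| k)%N.
Proof.
case: n => [|n]; first by rewrite pdvd0 dvd1n.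
rewrite pdvdS padic_natE -[0]/(0%:R) Zp_nat_eq mod0n; exact/eqP/eqP.
Qed.

Lemma pdvd_eq0 x : (forall n, pdvd n x) -> x = 0.
Proof. by move=> h; apply: padic_eqP => n; apply/eqP; rewrite -pdvdS. Qed.

(** Multiplication by [p] loses one digit of precision, which the next component
    of the product still determines. *)
Lemma pexp_mulI n : injective (fun x : Zp => p%:R ^+ n * x).
Proof.
suff p0 x : p%:R * x = 0 -> x = 0.
  move=> x y /eqP; rewrite -subr_eq0 -mulrBr => h; apply/eqP; rewrite -subr_eq0.
  move/eqP: h; elim: n (x - y) => [|k IH] z; first by rewrite mul1r => ->.
  by move=> /=; rewrite exprS -mulrA => /p0/IH.
move=> px; clear n; apply: pdvd_eq0 => -[|n]; first exact: pdvd0.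
rewrite pdvdS; have := congr1 (fun y : Zp => y n.+1) px.
have -> : (p%:R * x) n.+1 = p%:R * x n.+1 by rewrite -padic_natE.
move=> h; have : (p * x n.+1)%:R = 0%:R :> 'Z_(p ^ n.+2) by rewrite natrM natr_Zp.
move/eqP; rewrite Zp_nat_eq mod0n => {}h.
have {h} : (p * p ^ n.+1 %| p * x n.+1)%N by rewrite -expnS.
rewrite dvdn_pmul2l ?prime_gt0 // => /eqP h.
by apply/eqP/val_inj => /=; rewrite (padic_val_mod x (m := n) (n := n.+1)) // h.
Qed.

Lemma pdvdM2l m n x : pdvd (m + n) (p%:R ^+ m * x) = pdvd n x.
Proof.
apply/idP/idP => [/pdvdP[y]|]; last exact: pdvdMexp.
by rewrite exprD -mulrA => /pexp_mulI ->; apply/pdvdP; exists y.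
Qed.

(** Subtraction on exponents is truncated, which is what divisibility wants: no
    condition is left once [n <= m]. *)
Lemma pdvdM2l_sub m n x : pdvd n (p%:R ^+ m * x) = pdvd (n - m) x.
Proof.
have [nm|/ltnW mn] := leqP n m; last by rewrite -{1}(subnKC mn) pdvdM2l.
by rewrite (eqP nm) pdvd0 pdvdMr // pdvd_exp.
Qed.

(** When [p] does not divide [x], every component is invertible, and the inverses
    are coherent because inverses are unique. *)
Lemma padic_unitE x : (x \is a GRing.unit) = ~~ pdvd 1 x.
Proof.
apply/idP/idP => [ux|].
  apply/negP => /(pdvdMl (x^-1)); rewrite mulVr // -[1]/(1%:R) pdvd_nat expn1.
  by rewrite dvdn1 eqn_leq leqNgt prime_gt1.
move=> x1.
have ux n : x n \is a GRing.unit.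
  rewrite -[x n]natr_Zp unitZpE ?pexp_gt1 // coprime_pexpl // prime_coprime //.
  apply: contra x1 => h; rewrite pdvdS; apply/eqP/val_inj => /=.
  by rewrite (padic_val_mod x (m := 0) (n := n)) // expn1; apply/eqP.
have cs n : (x n)^-1 = (nat_of_ord (x n.+1)^-1)%:R.
  have := congr1 (fun v : 'Z_(p ^ n.+2) => (v : nat)%:R : 'Z_(p ^ n.+1))
    (divrr (ux n.+1)).
  rewrite [in LHS]/= padic_natr_mod natrM -padic_coherent => e.
  by apply: (mulrI (ux n)); exact: etrans (divrr (ux n)) (esym e).
apply/unitrP; exists (PadicInt cs); split; apply: padic_eqP => n.
  exact: (mulVr (ux n)).
exact: (divrr (ux n)).
Qed.

Lemma pdvdMu n u x : u \is a GRing.unit -> pdvd n (u * x) = pdvd n x.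
Proof.
by move=> uu; apply/idP/idP => [/(pdvdMl u^-1)|]; rewrite ?mulKr //; apply: pdvdMl.
Qed.

Lemma padic_factor x : x != 0 ->
  exists k, exists2 u, u \is a GRing.unit & x = p%:R ^+ k * u.
Proof.
move=> x0; have : exists n, ~~ pdvd n x.
  apply: contrapT => /forallNP h; move/eqP: x0; apply; apply: pdvd_eq0 => n.
  by apply: contrapT => /negP; exact: h.
case/ex_minnP => -[|k]; first by rewrite pdvd0.
move=> xk min; exists k.
have /pdvdP[u xu] : pdvd k x.
  by apply: contrapT => /negP /min; rewrite ltnn.
exists u => //; rewrite padic_unitE; apply: contra xk => h.
by rewrite xu -addn1 pdvdM2l.
Qed.

Lemma padic_abs_exp (R : realType) k u : u \is a GRing.unit ->
  padic_abs R (p%:R ^+ k * u) = p%:R ^- k.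
Proof.
move=> uu; rewrite /padic_abs.
have dk n : ((p%:R ^+ k * u : Zp) n != 0) = (k <= n)%N.
  rewrite -pdvdS; have [kn|nk] := leqP k n; last by rewrite pdvdMr ?pdvd_exp.
  rewrite mulrC pdvdMu //; apply/negP.
  rewrite -natrX pdvd_nat dvdn_Pexp2l ?prime_gt1 //.
  by rewrite ltnNge kn.
case: pselect => [h|[]]; last by exists k; rewrite dk.
case: ex_minnP => n; rewrite dk => kn min; congr (_ ^- _).
by apply/eqP; rewrite eqn_leq kn min // dk.
Qed.

Lemma padic_abs0 (R : realType) : padic_abs R (0 : Zp) = 0.
Proof. by rewrite /padic_abs; case: pselect => // h; exfalso; case: h => n; rewrite eqxx. Qed.

(** The standard representative modulo [p ^ n]. The shift by one matches the
    indexing of the components. *)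
Definition pres n x : nat := if n is m.+1 then x m : nat else 0%N.

Lemma pres_lt n x : (pres n x < p ^ n)%N.
Proof. by case: n => //= n; exact: padic_val_lt. Qed.

Lemma presP n x : pdvd n (x - (pres n x)%:R).
Proof.
case: n => [|n]; first exact: pdvd0.
rewrite pdvdS; have -> : (x - (pres n.+1 x)%:R) n = x n - (pres n.+1 x)%:R.
  by rewrite -padic_natE.
by rewrite /= natr_Zp subrr.
Qed.

Lemma pdvd_nat_sub n (i j : nat) :
  pdvd n (i%:R - j%:R) = (i == j %[mod p ^ n])%N.
Proof.
wlog ji : i j / (j <= i)%N => [hw|].
  by case: (leqP j i) => [/hw //|/ltnW/hw e]; rewrite pdvdBC e eq_sym.
by rewrite -natrB // pdvd_nat eqn_mod_dvd.
Qed.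

Lemma pdvd_nat_inj n (i j : nat) : (i < p ^ n)%N -> (j < p ^ n)%N ->
  pdvd n (i%:R - j%:R) -> i = j.
Proof. by move=> hi hj; rewrite pdvd_nat_sub !modn_small // => /eqP. Qed.

Lemma padic_lim (w : nat -> Zp) :
  (forall n, pdvd n.+1 (w n.+1 - w n)) ->
  exists x, forall n, pdvd n.+1 (x - w n).
Proof.
move=> hw; have cs n : w n n = (w n.+1 n.+1 : nat)%:R.
  rewrite -padic_coherent; apply/eqP; rewrite eq_sym -subr_eq0.
  by have := hw n; rewrite pdvdS.
exists (PadicInt cs) => n; rewrite pdvdS.
have -> : (PadicInt cs - w n) n = w n n - w n n by [].
by rewrite subrr.
Qed.

(** Hensel's lemma for squares, by Newton's iteration: if [w ^ 2] is close to
    [rho], then the square of the next iterate differs from [rho] by the square of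
    the correction, which is divisible by a higher power of [p]. *)
Lemma padic_sqrt (rho : Zp) : (2 < p)%N ->
  rho \is a GRing.unit ->
  ~ nonsquare_mod rho -> exists2 u, u \is a GRing.unit & rho = u ^+ 2.
Proof.
move=> p_odd urho /contrapT[y [z rhoyz]].
have p1 : pdvd 1 (p%:R : Zp) by rewrite -[p%:R]expr1 pdvd_exp.
have uy : y \is a GRing.unit.
  rewrite padic_unitE; apply: contraL urho => h.
  by rewrite padic_unitE negbK rhoyz pdvdD ?pdvdMr.
have u2 : 2%:R \is a @GRing.unit Zp.
  rewrite padic_unitE pdvd_nat expn1 gtnNdvd //.
pose step w : Zp := w - (w ^+ 2 - rho) / (2%:R * w).
pose w := fix w n := if n is m.+1 then step (w m) else y.
have hw n : w n \is a GRing.unit /\ pdvd n.+1 (w n ^+ 2 - rho).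
  elim: n => [|n [un dn]] /=.
    by split => //; rewrite rhoyz opprD addNKr pdvdN pdvdMr.
  have /pdvdP[q eq] := dn; have u2w : 2%:R * w n \is a GRing.unit by rewrite unitrM u2.
  have ds : pdvd n.+1 (w n - step (w n)) by rewrite /step subKr pdvdMr.
  split.
    rewrite padic_unitE -(pdvd_congr (x := w n)) -?padic_unitE //.
    exact: pdvd_le ds.
  have -> : step (w n) ^+ 2 - rho = ((w n ^+ 2 - rho) / (2%:R * w n)) ^+ 2.
    rewrite /step; have := divrK u2w (w n ^+ 2 - rho).
    move: (_ / _) => h e.
    have -> : (w n - h) ^+ 2 - rho =
              h ^+ 2 + ((w n ^+ 2 - rho) - h * (2%:R * w n)) by ring.
    by rewrite e subrr addr0.
  rewrite eq !exprMn -exprM -mulrA pdvdMr // pdvd_exp //.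
  by rewrite muln2 -addnn addnS ltnS addSn ltnS leq_addr.
have [|u hu] := padic_lim (w := w).
  by move=> n; have [un dn] := hw n; rewrite /= /step addrAC subrr add0r pdvdN pdvdMr.
have e : rho = u ^+ 2.
  apply/eqP; rewrite -subr_eq0; apply/eqP/pdvd_eq0 => -[|n]; first exact: pdvd0.
  have -> : rho - u ^+ 2 = - (w n ^+ 2 - rho) - (u - w n) * (u + w n) by ring.
  by rewrite pdvdD ?pdvdN ?pdvdMr //; have [] := hw n.
by exists u => //; move: urho; rewrite e unitrX_pos.
Qed.

(** The nonzero ideals are generated by powers of [p]: an element of minimal
    valuation generates, and it is a power of [p] up to a unit. *)
Lemma padic_ideal (I : set Zp) n : I 0 ->
  (forall a x y, I x -> I y -> I (a * x + y)) -> I (p%:R ^+ n) ->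
  exists2 a, I (p%:R ^+ a) & forall x, I x = pdvd a x.
Proof.
move=> I0 Ic In; have hex : exists n, `[< I (p%:R ^+ n) >] by exists n; apply/asboolP.
case: (ex_minnP hex) => a /asboolP Ia min; exists a => // x.
apply/propext; split=> [Ix|/pdvdP[y ->]]; last first.
  by rewrite mulrC -[y * _]addr0; apply: Ic.
have [->|/padic_factor[k [u uu xu]]] := eqVneq x 0; first exact: pdvdn0.
rewrite xu pdvdMr // pdvd_exp // min //; apply/asboolP.
rewrite -[X in I X]addr0 -[_ ^+ k](mulrK uu) -xu mulrC; exact: Ic.
Qed.

End PadicArithmetic.

(** * Counting residues *)
Section ResidueCounting.
Variable p : nat.
Hypothesis p_pr : prime p.
Local Notation Zp := (padic_int p).
Implicit Types (x y z u : Zp) (m n k : nat) (P : Zp -> nat).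

(** Functions on residue classes modulo [p ^ n] and their sums over all classes.
    Sums of natural numbers, rather than cardinals, let products of indicators and
    counts of fibres be treated in the same way. *)
Definition periodic n P := forall x y, pdvd n (x - y) -> P x = P y.

Definition cnt n P : nat := (\sum_(i < p ^ n) P i%:R)%N.

Lemma eq_cnt n P Q : P =1 Q -> cnt n P = cnt n Q.
Proof. by move=> e; apply: eq_bigr => i _. Qed.

(** A map that is injective modulo [p ^ n] permutes the residue classes; below it
    is a translation or the multiplication by a unit. *)
Lemma cnt_reindex n (g : Zp -> Zp) P :
  (forall x y, pdvd n (g x - g y) -> pdvd n (x - y)) -> periodic n P ->
  cnt n (P \o g) = cnt n P.
Proof.
move=> hg hP; pose h (i : 'I_(p ^ n)) := Ordinal (pres_lt p_pr n (g i%:R)).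
have hb : injective h.
  move=> i j /(congr1 val) /= hij; apply/val_inj.
  apply: (pdvd_nat_inj p_pr (ltn_ord i) (ltn_ord j)); apply: hg.
   have := presP p_pr n (g i%:R); rewrite hij => hi.
  set r := (pres _ _)%:R in hi; have -> : g i%:R - g j%:R = (g i%:R - r) - (g j%:R - r).
    by rewrite opprB addrA subrK.
  by rewrite pdvdD ?pdvdN ?presP.
rewrite /cnt [RHS](reindex_inj hb); apply: eq_bigr => i _ /=.
exact/hP/presP.
Qed.

Lemma cnt_lift m n P : periodic n P -> cnt (n + m) P = (p ^ m * cnt n P)%N.
Proof.
move=> hP; rewrite /cnt expnD mulnC; elim: (p ^ m)%N => [|q IH].
  by rewrite mul0n big_ord0.
rewrite mulSn addnC big_split_ord /= IH mulSnr; congr (_ + _)%N.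
apply: eq_bigr => i _; apply: hP.
by rewrite natrD addrK pdvd_nat // dvdn_mull.
Qed.

Lemma cnt_mulp n P :
  cnt n.+1 (fun x => pdvd 1 x * P x)%N = cnt n (fun x => P (p%:R * x)).
Proof.
rewrite /cnt expnS; have p0 := prime_gt0 p_pr.
under eq_bigr => i _ do rewrite pdvd_nat // expn1 mulnbl.
rewrite -big_mkcond /=.
have hp (i : 'I_(p ^ n)) : (p * i < p * p ^ n)%N by rewrite ltn_pmul2l.
have hq (i : 'I_(p * p ^ n)) : (i %/ p < p ^ n)%N.
  by rewrite ltn_divLR // (leq_trans (ltn_ord i)) // mulnC.
rewrite (reindex_onto (fun i => Ordinal (hp i)) (fun i => Ordinal (hq i))) /=.
  apply: eq_big => [i|i _]; last by rewrite natrM.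
  by rewrite dvdn_mulr //= -val_eqE /= mulKn // eqxx.
by move=> i di; apply: val_inj; rewrite /= mulnC divnK.
Qed.

Lemma cnt0 P : cnt 0 P = P 0.
Proof. by rewrite /cnt expn0 big_ord1. Qed.

Lemma periodic_pdvd m (c : Zp) : periodic m (fun x => pdvd m (x - c)).
Proof.
move=> x y xy; congr nat_of_bool; apply: pdvd_congr.
by rewrite opprB addrA subrK.
Qed.

Lemma cnt_pdvd m n (c : Zp) : (m <= n)%N -> cnt n (fun x => pdvd m (x - c)) = (p ^ (n - m))%N.
Proof.
move=> mn; rewrite -{1}(subnKC mn) cnt_lift; last exact: periodic_pdvd.
rewrite -[RHS]muln1; congr muln.
rewrite -(@cnt_reindex m (fun x => x + c)); first last.
- exact: periodic_pdvd.
- by move=> x y; rewrite opprD addrACA subrr addr0.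
rewrite /cnt (bigD1 (Ordinal (pexp_gt0 p_pr m))) //= addrK pdvdn0 big1 // => i i0.
rewrite /= addrK -[i%:R]subr0; case: (boolP (pdvd _ _)) => // h; case/negP: i0.
apply/eqP/val_inj; exact: (pdvd_nat_inj p_pr (ltn_ord i) (pexp_gt0 p_pr m)).
Qed.

Lemma cnt_unit n : cnt n.+1 (fun x => ~~ pdvd 1 x) = (p ^ n.+1 - p ^ n)%N.
Proof.
have := @cnt_pdvd 1 n.+1 0 isT; rewrite subn1 /= => <-.
have -> : (p ^ n.+1 = cnt n.+1 (fun=> 1))%N.
  by rewrite /cnt sum_nat_const card_ord muln1.
rewrite (_ : cnt n.+1 (fun=> 1%N) =
  (cnt n.+1 (fun x => ~~ pdvd 1 x) + cnt n.+1 (fun x => pdvd 1 (x - 0)%R))%N) ?addnK //.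
rewrite /cnt -big_split; apply: eq_bigr => i _ /=.
by rewrite subr0; case: pdvd.
Qed.

Lemma pdvd_expu n k u : u \is a GRing.unit -> pdvd n (p%:R ^+ k * u) = (n <= k)%N.
Proof.
by move=> uu; rewrite mulrC pdvdMu // -natrX pdvd_nat // dvdn_Pexp2l // prime_gt1.
Qed.

Lemma pdvd_sqr n x : pdvd n (x ^+ 2) = pdvd (uphalf n) x.
Proof.
have [->|/(padic_factor p_pr)[k [u uu ->]]] := eqVneq x 0.
  by rewrite expr0n /= !pdvdn0.
rewrite exprMn -exprM !pdvd_expu ?unitrX // muln2.
by rewrite leq_uphalf_double.
Qed.

(** ** Square roots modulo prime powers *)

Definition roots (delta : Zp) j := cnt j (fun z => pdvd j (z ^+ 2 - delta)).

(** The number of square roots of [delta] modulo all large powers of [p], where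
    [delta] is in the class given by [sq] and [k]. *)
Definition root_limit (sq : bool) k := (if sq && ~~ odd k then 2 * p ^ k./2 else 0)%N.

Lemma periodic_sqr j (delta : Zp) : periodic j (fun z => pdvd j (z ^+ 2 - delta)).
Proof.
move=> x y xy; congr nat_of_bool; apply: pdvd_congr.
by rewrite opprB addrA subrK subr_sqr pdvdMr.
Qed.

(** Modulo [p ^ j] the constant term vanishes, and [p ^ j] divides [z ^ 2] exactly
    when [z] is divisible by [p] to the power half of [j], rounded up. *)
Lemma roots_small k j w : (j <= k)%N -> roots (p%:R ^+ k * w) j = (p ^ j./2)%N.
Proof.
move=> jk; rewrite /roots.
rewrite (eq_cnt _ (Q := fun z => pdvd (uphalf j) (z - 0))).
  rewrite cnt_pdvd; last by have := uphalf_half j; have := odd_double_half j; lia.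
  by congr (_ ^ _)%N; have := uphalf_half j; have := odd_double_half j; lia.
move=> z; rewrite subr0 -pdvd_sqr; congr nat_of_bool; apply: pdvd_congr.
by rewrite addrAC subrr add0r pdvdN pdvdMr // pdvd_exp.
Qed.

Lemma pdvdM m n x y : pdvd m x -> pdvd n y -> pdvd (m + n) (x * y).
Proof.
move=> /pdvdP[x' ->] /pdvdP[y' ->]; apply/pdvdP; exists (x' * y').
by rewrite exprD mulrACA.
Qed.

(** If [z ^ 2] is closer to [delta] than the valuation [k] of [delta], then
    [z ^ 2] has valuation [k] too: so [k] is even, and half of it can be removed
    from [z]. *)
Lemma square_root_val j k w z : w \is a GRing.unit -> (k < j)%N ->
  pdvd j (z ^+ 2 - p%:R ^+ k * w) -> ~~ odd k /\
  exists2 z', z = p%:R ^+ k./2 * z' & pdvd (j - k) (z' ^+ 2 - w).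
Proof.
move=> uw kj h; have : pdvd k (z ^+ 2).
  by rewrite (pdvd_congr (pdvd_le (ltnW kj) h)) pdvdMr // pdvd_exp.
rewrite pdvd_sqr => /pdvdP[z' ez]; move: h; rewrite -{1}(subnKC (ltnW kj)) {1}ez.
rewrite exprMn -exprM muln2 uphalfK (addnC (odd k)).
have [ko|ke] := boolP (odd k).
  rewrite exprD expr1 -mulrA -mulrBr pdvdM2l // => h.
  have : pdvd 1 (p%:R * z' ^+ 2 - w) by apply: pdvd_le h; rewrite subn_gt0.
  have pp : pdvd 1 (p%:R * z' ^+ 2) by rewrite pdvdMr // -[p%:R]expr1 pdvd_exp.
  by rewrite pdvdDl // pdvdN => h1; move: uw; rewrite padic_unitE // h1.
rewrite addn0 -mulrBr pdvdM2l // => h; split=> //; exists z' => //.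
by rewrite ez uphalf_half (negbTE ke).
Qed.

Lemma cntD n P Q : cnt n (fun x => P x + Q x)%N = (cnt n P + cnt n Q)%N.
Proof. exact: big_split. Qed.

Lemma pdvd_split n x y : (x - y) \is a GRing.unit -> pdvd n (x * y) = pdvd n x || pdvd n y.
Proof.
move=> uxy; apply/idP/orP => [h|[]?]; [|exact: pdvdMr|exact: pdvdMl].
have [x1|] := boolP (pdvd 1 x); last first.
  by rewrite -padic_unitE // => ux; right; rewrite -(pdvdMu _ _ ux).
left; rewrite -(@pdvdMu _ n y) 1?mulrC //; rewrite padic_unitE //.
by move: uxy; rewrite padic_unitE // pdvdDl // pdvdN.
Qed.

(** After removing half of the valuation, the two factors of [z ^ 2 - u ^ 2]
    differ by the unit [2 * u], so one of them absorbs the whole power of [p]: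
    this leaves two classes of roots when [delta] is a square, and none
    otherwise. *)
Lemma roots_large (sq : bool) k j delta : (2 < p)%N -> delta_class sq k delta ->
  (k < j)%N -> roots delta j = root_limit sq k.
Proof.
move=> p_odd; rewrite /root_limit; case: sq => /=; last first.
  move=> [w [uw nsq ->]] kj; rewrite /roots /cnt big1 // => i _.
  case: (boolP (pdvd _ _)) => // /(square_root_val uw kj) [_ [z _ h]].
  case: nsq; have /pdvdP[y hy] : pdvd 1 (z ^+ 2 - w).
    by apply: pdvd_le h; rewrite subn_gt0.
  by exists z, (- y); rewrite mulrN -(expr1 p%:R) -hy opprB addrC subrK.
move=> [u uu ->] kj; have uw : u ^+ 2 \is a GRing.unit by rewrite unitrX.
have [ko|ke] := boolP (odd k).
  rewrite /roots /cnt big1 // => i _.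
  case: (boolP (pdvd _ _)) => // /(square_root_val uw kj) [].
  by rewrite ko.
set h := k./2; have hk : (k = h + h)%N by rewrite addnn -[LHS]odd_double_half (negbTE ke).
have hj : (h <= j - h)%N by lia.
have u2 : 2%:R * u \is a GRing.unit.
  by rewrite unitrM uu andbT padic_unitE // pdvd_nat // expn1 gtnNdvd.
rewrite /roots (eq_cnt _ (Q := fun z => (pdvd (j - h) (z - p%:R ^+ h * u)%R +
    pdvd (j - h) (z - - (p%:R ^+ h * u))%R)%N)).
  by rewrite cntD !cnt_pdvd ?leq_subr // subKn ?addnn ?mul2n //; lia.
move=> z; rewrite opprK.
have sub : (z + p%:R ^+ h * u) - (z - p%:R ^+ h * u) = p%:R ^+ h * (2%:R * u).
  by ring.
have fac : z ^+ 2 - p%:R ^+ k * u ^+ 2 = (z - p%:R ^+ h * u) * (z + p%:R ^+ h * u).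
  by rewrite -subr_sqr exprMn -exprM muln2 -addnn -hk.
have -> : pdvd j (z ^+ 2 - p%:R ^+ k * u ^+ 2) =
    pdvd (j - h) (z - p%:R ^+ h * u) || pdvd (j - h) (z + p%:R ^+ h * u).
  have split (a b : Zp) : pdvd (j - h) a -> pdvd h b -> pdvd j (a * b).
    have e : (j = j - h + h)%N by lia.
    by move=> da db; rewrite e pdvdM.
  apply/idP/orP => [|[] d].
  - move=> /(square_root_val uw kj)[_ [z' -> ]]; rewrite -/h subr_sqr pdvd_split.
      rewrite -!mulrBr -mulrDr -(subnKC hj) !pdvdM2l //.
      have -> : (j - h - h = j - k)%N by lia.
      by case/orP => ?; [left|right].
    have -> : z' - u - (z' + u) = - (2%:R * u) by ring.
    by rewrite unitrN.
  - rewrite fac split // -(subrK (z - p%:R ^+ h * u) (_ + _)) sub.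
    by rewrite pdvdD ?pdvdMr ?pdvd_exp //; apply: pdvd_le d.
  rewrite fac mulrC split // -[z - _](subKr (z + p%:R ^+ h * u)) sub.
  by rewrite pdvdD ?pdvdN ?pdvdMr ?pdvd_exp //; apply: pdvd_le d.
case: (boolP (pdvd _ (z - _))) => d1; case: (boolP (pdvd _ (z + _))) => d2 //.
have := pdvdD d2; rewrite -pdvdN in d1; move=> /(_ _ d1); rewrite sub pdvd_expu //.
lia.
Qed.

(** ** Lattices stable under the multiplication by [p ^ e * sqrt delta] *)

Variable delta : Zp.

(** This condition says that the lattice spanned by the rows [(p ^ b, z)] and
    [(0, p ^ c)] is mapped into itself by [p ^ e] times the endomorphism that
    sends [(y1, y2)] to [(y2, delta * y1)], a square root of [delta]. *)
Definition stable e b c z := [&& (b <= e + c)%N, pdvd b (p%:R ^+ e * z) &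
  pdvd (b + c) (p%:R ^+ e * (z ^+ 2 - delta * p%:R ^+ (b.*2)))].

Definition hnf_count e b c := cnt c (fun z => stable e b c z).

Definition lattice_count e M := (\sum_(b < M.+1) hnf_count e b (M - b))%N.

(** The number of stable lattices of index [p ^ n] with cyclic quotient, that is,
    of points [x] of the projective line modulo [p ^ n] at which [p ^ e] times the
    form [x2 ^ 2 - delta * x3 ^ 2] vanishes. *)
Definition prim_count e n :=
  (if n == 0 then 1 else if n <= e then p ^ n + p ^ n.-1
   else p ^ e * roots delta (n - e))%N.

Lemma hnf_count0n e n : hnf_count e 0 n = (p ^ minn n e * roots delta (n - e))%N.
Proof.
rewrite /hnf_count (eq_cnt _ (Q := fun z => pdvd (n - e) (z ^+ 2 - delta))).
  rewrite -{1}(subnKC (geq_minl n e)) addnC minnE.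
  have -> : (n - (n - (n - e)) = n - e)%N by lia.
  exact/cnt_lift/periodic_sqr.
by move=> z; rewrite /stable /= add0n pdvd0 expr0 mulr1 pdvdM2l_sub.
Qed.

Lemma hnf_countn0 e n : hnf_count e n 0 = (n <= e)%N.
Proof.
rewrite /hnf_count cnt0 /stable !addn0 mulr0 pdvdn0 /=.
by case: (leqP n e) => //= ne; rewrite pdvdMr // pdvd_exp.
Qed.

(** The lattices contained in [p] times the ambient plane, namely those with
    [p] dividing [z], are in bijection with the lattices of exponents [b] and [c],
    and scaling preserves stability. If [z] is a unit, so is
    [z ^ 2 - delta * p ^ (2 * b)], and stability amounts to a bound on the index. *)
Lemma hnf_countSS e b c : hnf_count e b.+1 c.+1 =
  ((if (b + c).+2 <= e then p ^ c.+1 - p ^ c else 0) + hnf_count e b c)%N.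
Proof.
have bcE : (b.+1 + c.+1 = (b + c).+2)%N by rewrite addSn addnS.
rewrite /hnf_count (eq_cnt _ (Q := fun z =>
    ((~~ pdvd 1 z && stable e b.+1 c.+1 z)%B +
      pdvd 1 z * stable e b.+1 c.+1 z)%N)); last first.
  by move=> z; case: pdvd => /=; rewrite ?add0n ?mul1n ?addn0.
rewrite cntD cnt_mulp; congr (_ + _)%N.
  case: ifPn => be.
    rewrite -cnt_unit; apply: eq_cnt => z; case: (boolP (pdvd 1 z)) => // z1 /=.
    rewrite /stable bcE.
    by rewrite (_ : b < e + c.+1)%N ?pdvdMr ?pdvd_exp //; lia.
  rewrite /cnt big1 // => i _; case: (boolP (pdvd 1 _)) => // z1 /=.
  rewrite /stable bcE.
  have u : (i%:R ^+ 2 - delta * p%:R ^+ b.+1.*2) \is a GRing.unit.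
    rewrite padic_unitE //; apply: contra z1 => h.
    suff : pdvd 1 ((i%:R : Zp) ^+ 2) by rewrite pdvd_sqr.
    by rewrite (pdvd_congr h) pdvdMl // pdvd_exp.
  by rewrite (pdvd_expu _ _ u) (negbTE be) !andbF.
apply: eq_cnt => z; congr nat_of_bool; rewrite /stable bcE addnS ltnS.
congr [&& _, _ & _].
  by rewrite mulrCA -add1n -{3}(expr1 p%:R) pdvdM2l.
have -> : p%:R ^+ e * ((p%:R * z) ^+ 2 - delta * p%:R ^+ b.+1.*2) =
   p%:R ^+ 2 * (p%:R ^+ e * (z ^+ 2 - delta * p%:R ^+ b.*2)).
  have -> : p%:R ^+ b.+1.*2 = p%:R ^+ 2 * p%:R ^+ b.*2 :> Zp by rewrite doubleS -exprD.
  by ring.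
by rewrite -add2n pdvdM2l.
Qed.

Lemma sum_exp_telescope N : (\sum_(b < N) (p ^ (N - b) - p ^ (N - b).-1) = p ^ N - 1)%N.
Proof.
elim: N => [|N IH]; first by rewrite big_ord0.
rewrite big_ord_recl subn0 /=.
under eq_bigr => i _ do rewrite subSS.
rewrite IH; have := pexp_gt0 p_pr N; have : (p ^ N <= p ^ N.+1)%N.
  by rewrite leq_exp2l ?prime_gt1.
lia.
Qed.

Lemma roots0 : roots delta 0 = 1%N.
Proof. by rewrite /roots cnt0 pdvd0. Qed.

Lemma lattice_count0 e : lattice_count e 0 = prim_count e 0.
Proof. by rewrite /lattice_count big_ord1 subn0 hnf_countn0. Qed.

Lemma lattice_count1 e : lattice_count e 1 = prim_count e 1.
Proof.
rewrite /lattice_count big_ord_recl big_ord1 /= subn0 subnn hnf_count0n hnf_countn0.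
rewrite /prim_count; case: e => [|e] /=.
  by rewrite minn0 subn0 addn0.
by rewrite subSS sub0n roots0 muln1 (minn_idPl _).
Qed.

(** A lattice either lies in [p] times the plane or has a cyclic quotient; the
    telescoping sum gathers the points at infinity of the projective line. *)
Lemma lattice_countSS e M :
  lattice_count e M.+2 = (prim_count e M.+2 + lattice_count e M)%N.
Proof.
rewrite /lattice_count big_ord_recl /= subn0 hnf_count0n big_ord_recr /= subnn.
rewrite hnf_countn0 (eq_bigr (fun b : 'I_M.+1 =>
  ((if M.+2 <= e then p ^ (M.+1 - b) - p ^ (M.+1 - b).-1 else 0) +
   hnf_count e b (M - b))%N)); last first.
  move=> b _; have bM : (b <= M)%N by rewrite -ltnS ltn_ord.
  by rewrite /bump add1n subSS subSn // hnf_countSS subnKC // subSn.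
have addnACAC a b c d : (a + (b + c + d) = a + b + d + c)%N by lia.
rewrite big_split /= /bump add1n addnACAC; congr (_ + _)%N.
rewrite /prim_count /=; case: (leqP M.+2 e) => h.
  rewrite (eqP (h : _ - _ == 0)%N) roots0 muln1.
  by rewrite sum_exp_telescope; have := pexp_gt0 p_pr M.+1; lia.
by rewrite big1 ?addn0.
Qed.

(** A subalgebra of index [p ^ N] is given by its intersection with the abelian
    ideal, a lattice of some index [p ^ M], by the exponent [N - M] of its image in
    the quotient, and by one of [p ^ M] lifts of a generator of that image. *)
Definition algebra_count iota N :=
  (\sum_(M < N.+1) p ^ M * lattice_count (N - M + iota) M)%N.

Definition prim_algebra_count iota N :=
  (\sum_(M < N.+1) p ^ M * prim_count (N - M + iota) M)%N.

Variable iota : nat.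

Lemma algebra_count0 : algebra_count iota 0 = prim_algebra_count iota 0.
Proof. by rewrite /algebra_count /prim_algebra_count !big_ord1 lattice_count0. Qed.

Lemma algebra_count1 : algebra_count iota 1 = prim_algebra_count iota 1.
Proof.
rewrite /algebra_count /prim_algebra_count !big_ord_recl !big_ord0 /=.
by rewrite lattice_count0 lattice_count1.
Qed.

Lemma sum_ord_recl2 (F : nat -> nat) N :
  (\sum_(i < N.+2) F i = F 0 + F 1 + \sum_(i < N) F i.+2)%N.
Proof. by rewrite !big_ord_recl addnA. Qed.

Lemma algebra_countSS N : algebra_count iota N.+2 =
  (prim_algebra_count iota N.+2 + p ^ 2 * algebra_count iota N)%N.
Proof.
rewrite /algebra_count /prim_algebra_count.
rewrite (sum_ord_recl2 (fun M => p ^ M * lattice_count (N.+2 - M + iota) M)%N).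
rewrite (sum_ord_recl2 (fun M => p ^ M * prim_count (N.+2 - M + iota) M)%N).
rewrite lattice_count0 lattice_count1 -!addnA; do 2!congr (_ + _)%N.
rewrite big_distrr -big_split; apply: eq_bigr => i _ /=.
rewrite !subSS lattice_countSS mulnDr; congr (_ + _)%N.
by rewrite mulnA -expnD.
Qed.

Lemma prim_algebra_count0 : prim_algebra_count iota 0 = 1%N.
Proof. by rewrite /prim_algebra_count big_ord1. Qed.

Lemma prim_algebra_count1 :
  prim_algebra_count iota 1 = (1 + p * prim_count iota 1)%N.
Proof. by rewrite /prim_algebra_count !big_ord_recl big_ord0 /= addn0 expn1. Qed.

(** Raising both the index and the stability exponent by one multiplies
    [prim_count] by [p], except from index 0 to index 1, where [1] becomes
    [p + 1]; this and the two extreme terms are what the recurrence adds. *)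
Lemma prim_algebra_countSS N : prim_algebra_count iota N.+2 =
  (1 + p + p ^ N.+2 * prim_count iota N.+2 + p ^ 2 * prim_algebra_count iota N)%N.
Proof.
rewrite {1}/prim_algebra_count big_ord_recl big_ord_recr /= /bump /= add1n subnn.
rewrite (eq_bigr (fun i : 'I_N.+1 =>
  (p ^ 2 * (p ^ i * prim_count (N - i + iota) i) + p * (i == ord0))%N)); last first.
  move=> i _; rewrite /= add1n subSS; have := ltn_ord i; rewrite ltnS => iN.
  rewrite (subSn iN) addSn /prim_count -val_eqE /= ltnS.
  case: (nat_of_ord i) => [|k] /=; first by rewrite expn0 expn1; lia.
  by rewrite muln0 addn0 subSS; case: ifP => _; rewrite !expnS; lia.
have s1 : (\sum_(i < N.+1) (i == ord0) = 1)%N.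
  by rewrite (bigD1 ord0) //= big1 // => i /negbTE ->.
rewrite big_split -!big_distrr /= s1 -/(prim_algebra_count iota N).
rewrite (_ : prim_count _ 0 = 1%N) // expn0 !muln1.
by move: (p ^ 2 * _)%N (p ^ N.+2 * _)%N => u v; lia.
Qed.

(** ** Solutions of the binary form modulo prime powers *)

Definition solutions j :=
  cnt j (fun y => cnt j (fun x => pdvd j (x ^+ 2 - delta * y ^+ 2))).

Lemma solutions0 : solutions 0 = 1%N.
Proof. by rewrite /solutions !cnt0 pdvd0. Qed.

(** If [y] is a unit then [x / y] is a square root of [delta]. If [p] divides
    [y], it divides [x] as well, and [p ^ 2] comes out of the form. *)
Lemma solutionsS j : solutions j.+1 =
  ((p ^ j.+1 - p ^ j) * roots delta j.+1 +
   if j is j'.+1 then p ^ 2 * solutions j' else 1)%N.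
Proof.
rewrite /solutions (eq_cnt _ (Q := fun y =>
  (~~ pdvd 1 y * roots delta j.+1 + pdvd 1 y *
   cnt j.+1 (fun x => pdvd j.+1 (x ^+ 2 - delta * y ^+ 2)%R))%N)); last first.
  move=> y; case: (boolP (pdvd 1 y)) => /=; first by rewrite mul1n.
  rewrite -padic_unitE // => uy; rewrite mul1n mul0n addn0 /roots.
  rewrite -[LHS](@cnt_reindex _ (fun x => y * x)); first last.
  - move=> u v uv; congr nat_of_bool; apply: pdvd_congr.
    by rewrite opprB addrA subrK subr_sqr pdvdMr.
  - by move=> u v; rewrite -mulrBr pdvdMu.
  apply: eq_cnt => x /=; congr nat_of_bool.
  by rewrite exprMn [delta * _]mulrC -mulrBr pdvdMu // unitrX.
rewrite cntD cnt_mulp; congr (_ + _)%N.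
  by rewrite -(cnt_unit j) /cnt big_distrl.
pose f (y x : Zp) := nat_of_bool (pdvd (j.+1 - 2) (x ^+ 2 - delta * y ^+ 2)).
have pf m y : (j.+1 - 2 = m)%N -> periodic m (f y).
  move=> <- u v uv; congr nat_of_bool; apply: pdvd_congr.
  by rewrite opprB addrA subrK subr_sqr pdvdMr.
have pg m n : (j.+1 - 2 = m)%N -> periodic m (fun y => cnt n (f y)).
  move=> <- u v uv; apply: eq_cnt => z; congr nat_of_bool; apply: pdvd_congr.
  have -> : z ^+ 2 - delta * u ^+ 2 - (z ^+ 2 - delta * v ^+ 2) =
            - delta * (u + v) * (u - v) by ring.
  by rewrite pdvdMl.
have -> : cnt j (fun y => cnt j.+1
    (fun x => pdvd j.+1 (x ^+ 2 - delta * (p%:R * y) ^+ 2))) =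
    cnt j (fun y => cnt j (f y)).
  apply: eq_cnt => y.
  have := cnt_mulp j (fun x => pdvd j.+1 (x ^+ 2 - delta * (p%:R * y) ^+ 2)).
  rewrite (eq_cnt j (Q := f y)); last first.
    move=> x; have -> : (p%:R * x) ^+ 2 - delta * (p%:R * y) ^+ 2 =
      p%:R ^+ 2 * (x ^+ 2 - delta * y ^+ 2) by ring.
    by rewrite pdvdM2l_sub.
  move=> <-; apply: eq_cnt => x; case: (boolP (pdvd 1 x)) => x1; rewrite ?mul1n //=.
  rewrite mul0n; case: (boolP (pdvd _ _)) => // h; case/negP: x1.
  suff : pdvd 1 (x ^+ 2) by rewrite pdvd_sqr.
  rewrite (pdvd_congr (pdvd_le (isT : (1 <= j.+1)%N) h)) pdvdMl // exprMn pdvdMr //.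
  exact: pdvd_exp.
case: j @f pf pg => [|j] f pf pg; first by rewrite !cnt0 /f pdvd0.
rewrite -[j.+1]addn1 cnt_lift; last by apply: pg; rewrite !subSS subn0.
rewrite expn1 (expnS p 1) expn1 -mulnA; congr (_ * _)%N.
rewrite [RHS]big_distrr /=; apply: eq_bigr => i _ /=.
rewrite cnt_lift ?expn1 //; last by apply: pf; rewrite !subSS subn0.
by congr (_ * _)%N; apply: eq_cnt => x; rewrite /f !subSS subn0.
Qed.

End ResidueCounting.

(** * Subalgebras of finite index *)
Lemma finite_inj_image (I : finType) (T : choiceType) (A : set T) (g : I -> T) :
  injective g -> A = range g -> finite_set A /\ #|` fset_set A| = #|I|.
Proof.
move=> gi ->; have e : range g = [set` [fset g i | i in I]%fset].
  apply/seteqP; split=> [_ [i _ <-]|x /= /imfsetP[i _ ->]]; last by exists i.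
  by apply/imfsetP; exists i.
split; first by rewrite e; exact: finite_fset.
by rewrite e set_fsetK card_imfset //= -cardE.
Qed.

Section Subalgebras.
Variable p : nat.
Hypothesis p_pr : prime p.
Local Notation Zp := (padic_int p).
Variables (L : lmodType Zp) (br : L -> L -> L).

(** Coordinates in which the bracket with the first basis vector acts on the
    abelian ideal [X = 0] as the scalar [clam] plus [p ^ iota * ceps] times a
    square root of [delta]. Scalars preserve all lattices and units are harmless,
    so that only [iota] and [delta] matter for the subalgebras. *)
Record coordinates (iota : nat) (delta : Zp) := Coordinates {
  cX : L -> Zp; cY : L -> Zp; cZ : L -> Zp; cmk : Zp -> Zp -> Zp -> L;
  cX_lin : forall a u v, cX (a *: u + v) = a * cX u + cX v;
  cY_lin : forall a u v, cY (a *: u + v) = a * cY u + cY v;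
  cZ_lin : forall a u v, cZ (a *: u + v) = a * cZ u + cZ v;
  cX_mk : forall x y z, cX (cmk x y z) = x;
  cY_mk : forall x y z, cY (cmk x y z) = y;
  cZ_mk : forall x y z, cZ (cmk x y z) = z;
  c_inj : forall u v, cX u = cX v -> cY u = cY v -> cZ u = cZ v -> u = v;
  clam : Zp; ceps : Zp; ceps_unit : ceps \is a GRing.unit;
  br_X : forall u v, cX (br u v) = 0;
  br_Y : forall u v, cY (br u v) =
    cX u * (clam * cY v + p%:R ^+ iota * ceps * cZ v) -
    cX v * (clam * cY u + p%:R ^+ iota * ceps * cZ u);
  br_Z : forall u v, cZ (br u v) =
    cX u * (p%:R ^+ iota * ceps * delta * cY v + clam * cZ v) -
    cX v * (p%:R ^+ iota * ceps * delta * cY u + clam * cZ u) }.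

Variables (iota : nat) (delta : Zp) (C : coordinates iota delta).
Local Notation X := (cX C).
Local Notation Y := (cY C).
Local Notation Z := (cZ C).
Local Notation mk := (cmk C).
Local Notation lam := (clam C).
Local Notation eps := (ceps C).

Lemma cX0 : X 0 = 0.
Proof. by have := cX_lin C (-1) 0 0; rewrite scaler0 addr0 mulN1r addNr. Qed.
Lemma cY0 : Y 0 = 0.
Proof. by have := cY_lin C (-1) 0 0; rewrite scaler0 addr0 mulN1r addNr. Qed.
Lemma cZ0 : Z 0 = 0.
Proof. by have := cZ_lin C (-1) 0 0; rewrite scaler0 addr0 mulN1r addNr. Qed.
Lemma cXB u v : X (u - v) = X u - X v.
Proof. by rewrite addrC -scaleN1r cX_lin mulN1r addrC. Qed.
Lemma cYB u v : Y (u - v) = Y u - Y v.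
Proof. by rewrite addrC -scaleN1r cY_lin mulN1r addrC. Qed.
Lemma cZB u v : Z (u - v) = Z u - Z v.
Proof. by rewrite addrC -scaleN1r cZ_lin mulN1r addrC. Qed.

(** ** Index and uniqueness of Hermite normal forms *)

(** The span of the rows [(p ^ a, x, y)], [(0, p ^ b, z)] and [(0, 0, p ^ c)]; a
    triple of coefficients is packed in [t]. *)
Definition hnf (a b c : nat) (x y z : Zp) : set L :=
  [set l | exists t, [/\ X l = t.1.1 * p%:R ^+ a,
    Y l = t.1.1 * x + t.1.2 * p%:R ^+ b &
    Z l = t.1.1 * y + t.1.2 * z + t.2 * p%:R ^+ c]].

Lemma pexp_mulIr n : injective (fun x : Zp => x * p%:R ^+ n).
Proof. by move=> x y; rewrite ![_ * p%:R ^+ n]mulrC; exact: pexp_mulI. Qed.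

Lemma pexp_eq0 n (x : Zp) : x * p%:R ^+ n = 0 -> x = 0.
Proof. by move=> h; apply: (@pexp_mulIr n); rewrite mul0r. Qed.

Lemma pdvd_sub_lt n (i j : nat) (t : Zp) : (i < p ^ n)%N -> (j < p ^ n)%N ->
  i%:R - j%:R = t * p%:R ^+ n -> i = j /\ t = 0.
Proof.
move=> hi hj e; have ij : i = j.
  apply: (pdvd_nat_inj p_pr hi hj); apply/pdvdP; exists t; by rewrite e mulrC.
by split=> //; apply: (@pexp_eq0 n); rewrite -e ij subrr.
Qed.

Lemma hnf_submodule a b c x y z : submodule (hnf a b c x y z).
Proof.
split; first by exists (0, 0, 0); rewrite cX0 cY0 cZ0 /= !mul0r !addr0.
move=> r u v [[[a1 b1] c1] /= [hX hY hZ]] [[[a2 b2] c2] /= [hX2 hY2 hZ2]].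
exists (r * a1 + a2, r * b1 + b2, r * c1 + c2) => /=.
by split; rewrite ?cX_lin ?cY_lin ?cZ_lin ?hX ?hY ?hZ ?hX2 ?hY2 ?hZ2; ring.
Qed.

(** Triangular reduction: each coset contains exactly one vector whose
    coordinates are natural numbers below the diagonal entries. *)
Lemma hnf_cosets a b c x y z : finite_set (cosets (hnf a b c x y z)) /\
  sub_index (hnf a b c x y z) = (p ^ (a + b + c))%N.
Proof.
set H := hnf _ _ _ _ _ _; have [H0 HS] := hnf_submodule a b c x y z.
pose g (t : 'I_(p ^ a) * 'I_(p ^ b) * 'I_(p ^ c)) : set L :=
  [set l | H (l - mk t.1.1%:R t.1.2%:R t.2%:R)].
have -> : (p ^ (a + b + c) = #|{: 'I_(p ^ a) * 'I_(p ^ b) * 'I_(p ^ c)}|)%N.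
  by rewrite !card_prod !card_ord !expnD.
have HN u : H u -> H (- u).
  by move=> Hu; rewrite -[- u]addr0 -scaleN1r; apply: HS.
have HD u v : H u -> H v -> H (u + v).
  by move=> Hu; rewrite -[u]scale1r; apply: HS.
have cosE u v : H (u - v) -> [set l | H (l - u)] = [set l | H (l - v)].
  move=> Huv; apply/seteqP; split=> l /= Hl.
    by have := HD _ _ Hl Huv; rewrite addrA subrK.
  by have := HD _ _ Hl (HN _ Huv); rewrite opprB addrA subrK.
apply: (finite_inj_image (g := g)).
  move=> [[i j] k] [[i' j'] k'] /= e.
  have : g (i, j, k) (mk i%:R j%:R k%:R) by rewrite /g /= subrr.
  rewrite e => -[[[r s] t]] /=; rewrite cXB cYB cZB !cX_mk !cY_mk !cZ_mk.
  case=> /pdvd_sub_lt [] // /val_inj -> ->.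
  rewrite !mul0r !add0r => /pdvd_sub_lt [] // /val_inj -> ->.
  by rewrite !mul0r !add0r => /pdvd_sub_lt [] // /val_inj -> _.
apply/seteqP; split=> [_ [l _ <-]|_ [t _ <-]]; last first.
  by exists (mk t.1.1%:R t.1.2%:R t.2%:R).
have [r hr] := pdvdP _ _ (presP p_pr a (X l)).
have [s hs] := pdvdP _ _ (presP p_pr b (Y l - r * x)).
have [t ht] := pdvdP _ _ (presP p_pr c (Z l - r * y - s * z)).
exists (Ordinal (pres_lt p_pr a (X l)), Ordinal (pres_lt p_pr b (Y l - r * x)),
  Ordinal (pres_lt p_pr c (Z l - r * y - s * z))) => //.
apply/esym/cosE; exists (r, s, t) => /=; rewrite cXB cYB cZB !cX_mk !cY_mk !cZ_mk.
split; first by rewrite hr mulrC.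
  by rewrite [s * p%:R ^+ b]mulrC -hs; ring.
by rewrite [t * p%:R ^+ c]mulrC -ht; ring.
Qed.

Lemma hnf_mk1 a b c x y z : hnf a b c x y z (mk (p%:R ^+ a) x y).
Proof. by exists (1, 0, 0); rewrite cX_mk cY_mk cZ_mk; split => /=; ring. Qed.

Lemma hnf_mk2 a b c x y z : hnf a b c x y z (mk 0 (p%:R ^+ b) z).
Proof. by exists (0, 1, 0); rewrite cX_mk cY_mk cZ_mk; split => /=; ring. Qed.

Lemma hnf_mk3 a b c x y z : hnf a b c x y z (mk 0 0 (p%:R ^+ c)).
Proof. by exists (0, 0, 1); rewrite cX_mk cY_mk cZ_mk; split => /=; ring. Qed.

Lemma pexp_dvd_le m n (t : Zp) : p%:R ^+ n = t * p%:R ^+ m -> (m <= n)%N.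
Proof.
move=> e; rewrite -(pdvd_expu p_pr m n (unitr1 _)) mulr1.
by apply/pdvdP; exists t; rewrite mulrC.
Qed.

Lemma hnf_inj a b c (x y z : nat) a' b' c' (x' y' z' : nat) :
  [/\ x < p ^ b, y < p ^ c & z < p ^ c]%N ->
  [/\ x' < p ^ b', y' < p ^ c' & z' < p ^ c']%N ->
  hnf a b c x%:R y%:R z%:R = hnf a' b' c' x'%:R y'%:R z'%:R ->
  [/\ a = a', b = b' & c = c'] /\ [/\ x = x', y = y' & z = z'].
Proof.
have le a1 b1 c1 x1 y1 z1 a2 b2 c2 x2 y2 z2 :
    hnf a1 b1 c1 x1 y1 z1 = hnf a2 b2 c2 x2 y2 z2 ->
    [/\ a2 <= a1, b2 <= b1 & c2 <= c1]%N.
  move=> e; have := hnf_mk1 a1 b1 c1 x1 y1 z1; have := hnf_mk2 a1 b1 c1 x1 y1 z1.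
  have := hnf_mk3 a1 b1 c1 x1 y1 z1; rewrite e /hnf /= !cX_mk !cY_mk !cZ_mk.
  move=> [[[r s] t] /= [/esym/pexp_eq0 -> ]].
  rewrite !mul0r !add0r => /esym/pexp_eq0 ->; rewrite mul0r add0r => /pexp_dvd_le ->.
  move=> [[[r' s'] t'] /= [/esym/pexp_eq0 -> ]].
  rewrite !mul0r !add0r => /pexp_dvd_le -> _.
  by move=> [[[r'' s''] t''] /= [/pexp_dvd_le -> _ _]].
move=> [hx hy hz] [hx' hy' hz'] e.
have [aa bb cc] := le _ _ _ _ _ _ _ _ _ _ _ _ e.
have [aa' bb' cc'] := le _ _ _ _ _ _ _ _ _ _ _ _ (esym e).
have ea : a = a' by lia.
have eb : b = b' by lia.
have ec : c = c' by lia.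
subst a' b' c'; split=> //.
have := hnf_mk1 a b c x%:R y%:R z%:R; have := hnf_mk2 a b c x%:R y%:R z%:R.
rewrite e /hnf /= !cX_mk !cY_mk !cZ_mk => -[[[r s] t] /= [/esym/pexp_eq0 -> ]].
have one n (q : Zp) : p%:R ^+ n = q * p%:R ^+ n -> q = 1.
  by move=> h; apply: (@pexp_mulIr n); rewrite mul1r.
rewrite !mul0r !add0r => /one -> /eqP; rewrite mul1r addrC -subr_eq => /eqP.
move=> /(pdvd_sub_lt hz hz')[zz _].
move=> [[[r' s'] t'] /= [/one -> /eqP]].
rewrite !mul1r addrC -subr_eq => /eqP /(pdvd_sub_lt hx hx')[xx ->] /eqP.
rewrite mul0r addr0 addrC -subr_eq => /eqP /(pdvd_sub_lt hy hy')[yy _].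
by split.
Qed.

(** ** Existence of Hermite normal forms *)

(** Two of the infinitely many multiples [p ^ j *: u] lie in the same coset, and
    their difference is a unit times the smaller power of [p]. *)
Lemma finite_index_exp (H : set L) u : submodule H -> finite_index H ->
  exists n, H (p%:R ^+ n *: u).
Proof.
move=> [H0 HS] fH; pose g j := [set l | H (l - p%:R ^+ j *: u)].
have [j [k [jk e]]] : exists j k, (j < k)%N /\ g j = g k.
  apply: contrapT => h; apply: infinite_nat.
  have -> : [set: nat] = g @^-1` (cosets H).
    by apply/seteqP; split=> // j _; exists (p%:R ^+ j *: u).
  apply: finite_preimage fH => i j _ _ gij; apply: contrapT => ij; apply: h.
  have [lij|lji|//] := ltngtP i j; first by exists i, j.
  by exists j, i; rewrite gij.
exists j; have : g k (p%:R ^+ k *: u) by rewrite /g /= subrr.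
rewrite -e /g /= -scalerBl => h.
pose w : Zp := p%:R ^+ (k - j) - 1.
have uw : w \is a GRing.unit.
  rewrite padic_unitE // /w pdvdDl ?pdvd_exp ?subn_gt0 // pdvdN.
  by have := unitr1 Zp; rewrite padic_unitE.
have -> : p%:R ^+ j *: u = w^-1 *: ((p%:R ^+ k - p%:R ^+ j) *: u) + 0.
  rewrite addr0 scalerA; congr (_ *: _); rewrite -(subnKC (ltnW jk)) exprD.
  by rewrite -[X in _ - X]mulr1 -mulrBr mulrCA mulVr ?mulr1.
exact: HS.
Qed.

(** The diagonal entries generate the ideals of leading coordinates of the vectors
    in [H] whose preceding coordinates vanish. *)
Lemma hnf_exists (H : set L) : submodule H -> finite_index H ->
  exists a b c (x y z : nat), [/\ (x < p ^ b)%N, (y < p ^ c)%N, (z < p ^ c)%N &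
    H = hnf a b c x%:R y%:R z%:R].
Proof.
move=> sH fH; have [H0 HS] := sH.
have ideal (I : set Zp) (w : L) : I 0 ->
    (forall a x y, I x -> I y -> I (a * x + y)) ->
    (forall n, H (p%:R ^+ n *: w) -> I (p%:R ^+ n)) ->
    exists2 a, I (p%:R ^+ a) & forall x, I x = pdvd a x.
  move=> I0 IS Iw; have [n /Iw In] := finite_index_exp w sH fH.
  exact: (padic_ideal p_pr I0 IS In).
have ZX a w : X (a *: w) = a * X w by rewrite -[a *: w]addr0 cX_lin cX0 addr0.
have ZY a w : Y (a *: w) = a * Y w by rewrite -[a *: w]addr0 cY_lin cY0 addr0.
have ZZ a w : Z (a *: w) = a * Z w by rewrite -[a *: w]addr0 cZ_lin cZ0 addr0.
have [|||c [h3 [Hh3 X3 Y3 Z3]] Ic] := ideal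
   [set t | exists l, [/\ H l, X l = 0, Y l = 0 & Z l = t]] (mk 0 0 1).
- by exists 0; rewrite cX0 cY0 cZ0.
- move=> a _ _ [u [? e1 e2 <-]] [v [? e3 e4 <-]]; exists (a *: u + v).
  by rewrite cX_lin cY_lin cZ_lin e1 e2 e3 e4 mulr0 addr0; split=> //; exact: HS.
- move=> n Hn; exists (p%:R ^+ n *: mk 0 0 1).
  by rewrite ZX ZY ZZ cX_mk cY_mk cZ_mk !mulr0 mulr1.
have [|||b [h2 [Hh2 X2 Y2]] Ib] := ideal
   [set t | exists l, [/\ H l, X l = 0 & Y l = t]] (mk 0 1 0).
- by exists 0; rewrite cX0 cY0.
- move=> a _ _ [u [? e1 <-]] [v [? e3 <-]]; exists (a *: u + v).
  by rewrite cX_lin cY_lin e1 e3 mulr0 addr0; split=> //; exact: HS.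
- by move=> n Hn; exists (p%:R ^+ n *: mk 0 1 0); rewrite ZX ZY cX_mk cY_mk !mulr0 mulr1.
have [|||a [h1 Hh1 X1] Ia] := ideal [set t | exists2 l, H l & X l = t] (mk 1 0 0).
- by exists 0; rewrite ?cX0.
- by move=> a _ _ [u ? <-] [v ? <-]; exists (a *: u + v); rewrite ?cX_lin //; exact: HS.
- by move=> n Hn; exists (p%:R ^+ n *: mk 1 0 0); rewrite // ZX cX_mk !mulr1.
have HB u v r : H u -> H v -> H (u - r *: v).
  by move=> Hu Hv; rewrite addrC -scaleNr; apply: HS.
(* Reduce the second row by the third one, then the first by both. *)
have [z zb [h2' [Hh2' X2' Y2' Z2']]] : exists2 z, (z < p ^ c)%N &
    exists l, [/\ H l, X l = 0, Y l = p%:R ^+ b & Z l = z%:R].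
  exists (pres c (Z h2)); first exact: pres_lt.
  have /pdvdP[q hq] := presP p_pr c (Z h2).
  exists (h2 - q *: h3); rewrite cXB cYB cZB ZX ZY ZZ X2 X3 Y2 Y3 Z3 !mulr0 !subr0.
  by split=> //; [exact: HB|rewrite [q * _]mulrC -hq subKr].
have [x xb [h1' [Hh1' X1' Y1']]] : exists2 x, (x < p ^ b)%N &
    exists l, [/\ H l, X l = p%:R ^+ a & Y l = x%:R].
  exists (pres b (Y h1)); first exact: pres_lt.
  have /pdvdP[q hq] := presP p_pr b (Y h1).
  exists (h1 - q *: h2'); rewrite cXB cYB ZX ZY X1 X2' Y2' mulr0 subr0.
  by split=> //; [exact: HB|rewrite [q * _]mulrC -hq subKr].
have [y yb [h1'' [Hh1'' X1'' Y1'' Z1'']]] : exists2 y, (y < p ^ c)%N &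
    exists l, [/\ H l, X l = p%:R ^+ a, Y l = x%:R & Z l = y%:R].
  exists (pres c (Z h1')); first exact: pres_lt.
  have /pdvdP[q hq] := presP p_pr c (Z h1').
  exists (h1' - q *: h3); rewrite cXB cYB cZB ZX ZY ZZ X1' X3 Y1' Y3 Z3 !mulr0 !subr0.
  by split=> //; [exact: HB|rewrite [q * _]mulrC -hq subKr].
exists a, b, c, x, y, z; split=> //; apply/seteqP; split=> l; last first.
  move=> [[[r s] t] /= [Xl Yl Zl]].
  have -> : l = r *: h1'' + (s *: h2' + (t *: h3 + 0)).
    apply: (c_inj (c := C)); rewrite ?(cX_lin, cY_lin, cZ_lin) ?(cX0, cY0, cZ0).
    - by rewrite X1'' X2' X3 Xl; ring.
    - by rewrite Y1'' Y2' Y3 Yl; ring.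
    - by rewrite Z1'' Z2' Z3 Zl; ring.
  by apply: (HS)=> //; apply: (HS) => //; apply: (HS).
move=> Hl; have : [set t | exists2 l, H l & X l = t] (X l) by exists l.
rewrite Ia => /pdvdP[r hr].
have Hl1 := HB _ _ r Hl Hh1''; have X_l1 : X (l - r *: h1'') = 0.
  by rewrite cXB ZX X1'' hr mulrC subrr.
have : [set t | exists l, [/\ H l, X l = 0 & Y l = t]] (Y (l - r *: h1'')).
  by exists (l - r *: h1'').
rewrite Ib => /pdvdP[s hs].
have Hl2 := HB _ _ s Hl1 Hh2'; have X_l2 : X (l - r *: h1'' - s *: h2') = 0.
  by rewrite cXB X_l1 ZX X2' mulr0 subr0.
have Y_l2 : Y (l - r *: h1'' - s *: h2') = 0.
  by rewrite cYB hs ZY Y2' mulrC subrr.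
have : [set t | exists l, [/\ H l, X l = 0, Y l = 0 & Z l = t]]
   (Z (l - r *: h1'' - s *: h2')) by exists (l - r *: h1'' - s *: h2').
rewrite Ic => /pdvdP[t ht]; exists (r, s, t) => /=; split.
- by rewrite hr mulrC.
- by rewrite [s * _]mulrC -hs cYB ZY Y1'' addrC subrK.
- by rewrite [t * _]mulrC -ht !cZB !ZZ Z1'' Z2'; ring.
Qed.

(** ** Stability under the bracket *)

(** The bracket of two rows only involves the first coordinate of one and the
    action on the ideal of the other, so closure under the bracket says that
    [p ^ a] times the action preserves the lattice spanned by the last two rows. *)
Lemma hnf_subalgebra a b c (x y z : Zp) :
  subalgebra br (hnf a b c x y z) <-> stable delta (a + iota) b c z.
Proof.
set H := hnf a b c x y z; have pI := @pexp_mulI p p_pr.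
have ue : eps \is a GRing.unit := ceps_unit C.
split=> [[_ Hbr]|].
  have [[[r s] t] /= []] := Hbr _ _ (hnf_mk1 a b c x y z) (hnf_mk2 a b c x y z).
  rewrite br_X br_Y br_Z !cX_mk !cY_mk !cZ_mk => /esym/pexp_eq0 ->.
  rewrite !mul0r !subr0 !add0r => hY hZ.
  have [[[r' s'] t'] /= []] := Hbr _ _ (hnf_mk1 a b c x y z) (hnf_mk3 a b c x y z).
  rewrite br_X br_Y br_Z !cX_mk !cY_mk !cZ_mk => /esym/pexp_eq0 ->.
  rewrite !mul0r !subr0 !add0r !mulr0 !add0r => hY' _.
  have q2 : p%:R ^+ (a + iota + c) * eps = p%:R ^+ b * s'.
    by rewrite [RHS]mulrC -hY' !exprD; ring.
  have q1 : p%:R ^+ (a + iota) * (eps * z) = p%:R ^+ b * (s - p%:R ^+ a * clam C).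
    by rewrite mulrBr [p%:R ^+ b * s]mulrC -hY exprD; ring.
  apply/and3P; split.
  - rewrite -(pdvd_expu p_pr b (a + iota + c) ue) q2; apply/pdvdP; by exists s'.
  - have := pdvdMu b (p%:R ^+ (a + iota) * z) ue => <-.
    by rewrite mulrCA q1; apply/pdvdP; exists (s - p%:R ^+ a * clam C).
  - have := pdvdMu (b + c) (p%:R ^+ (a + iota) * (z ^+ 2 - delta * p%:R ^+ b.*2)) ue => <-.
    apply/pdvdP; exists (- t).
    have hZ' : t * p%:R ^+ c = p%:R ^+ (a + iota) * eps * delta * p%:R ^+ b -
        (s - p%:R ^+ a * clam C) * z.
      have -> : t * p%:R ^+ c = (s * z + t * p%:R ^+ c) - s * z by ring.
      by rewrite -hZ exprD; ring.
    have -> : p%:R ^+ (b + c) * - t = - (p%:R ^+ b * (t * p%:R ^+ c)).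
      by rewrite exprD; ring.
    have wE (u v w : Zp) : - (w * (u - v * z)) = w * v * z - w * u by ring.
    by rewrite hZ' wE -q1 -addnn [p%:R ^+ (b + b)]exprD; ring.
case/and3P => bec /pdvdP[q1 h1] /pdvdP[q3 h3]; split; first exact: hnf_submodule.
pose q2 : Zp := p%:R ^+ (a + iota + c - b).
have h2 : p%:R ^+ (a + iota + c) = p%:R ^+ b * q2 by rewrite -exprD subnKC.
have e1 : q2 * z = p%:R ^+ c * q1.
  by apply: (pI b); rewrite mulrA -h2 exprD mulrCA -h1; ring.
have e2 : p%:R ^+ (a + iota) * delta * p%:R ^+ b = q1 * z - p%:R ^+ c * q3.
  apply: (pI b); have -> : p%:R ^+ b * (q1 * z - p%:R ^+ c * q3) =
    (p%:R ^+ b * q1) * z - (p%:R ^+ b * p%:R ^+ c) * q3 by ring.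
  by rewrite -h1 -[p%:R ^+ b * p%:R ^+ c]exprD -h3 -addnn [p%:R ^+ (b + b)]exprD; ring.
move=> u v [[[r s] t] /= [Xu Yu Zu]] [[[r' s'] t'] /= [Xv Yv Zv]].
exists (0, p%:R ^+ a * clam C * (r * s' - r' * s) +
           eps * (q1 * (r * s' - r' * s) + q2 * (r * t' - r' * t)),
        p%:R ^+ a * clam C * (r * t' - r' * t) -
        eps * (q3 * (r * s' - r' * s) + q1 * (r * t' - r' * t))) => /=.
rewrite br_X br_Y br_Z Xu Yu Zu Xv Yv Zv !mul0r !add0r; split=> //.
- have zE : p%:R ^+ (a + iota) * eps * z = p%:R ^+ b * q1 * eps by rewrite -h1; ring.
  have cE : p%:R ^+ (a + iota) * eps * p%:R ^+ c = p%:R ^+ b * q2 * eps.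
    by rewrite -h2 !exprD; ring.
  transitivity (p%:R ^+ a * clam C * (r * s' - r' * s) * p%:R ^+ b +
    (r * s' - r' * s) * (p%:R ^+ (a + iota) * eps * z) +
    (r * t' - r' * t) * (p%:R ^+ (a + iota) * eps * p%:R ^+ c)).
    by rewrite exprD; ring.
  by rewrite zE cE; ring.
transitivity (p%:R ^+ a * clam C * ((r * s' - r' * s) * z + (r * t' - r' * t) * p%:R ^+ c)
   + eps * (r * s' - r' * s) * (p%:R ^+ (a + iota) * delta * p%:R ^+ b)).
  by rewrite exprD; ring.
rewrite e2; have -> (A : Zp) :
  (A + eps * (q1 * (r * s' - r' * s) + q2 * (r * t' - r' * t))) * z =
  A * z + eps * q1 * z * (r * s' - r' * s) + eps * (r * t' - r' * t) * (q2 * z) by ring.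
by rewrite e1; ring.
Qed.

(** ** Subalgebras of a given index *)

(** Reduced Hermite normal forms of index [p ^ N]: here [M] is the exponent of the
    index of the lattice in the ideal and [b] its first diagonal exponent. *)
Definition hnf_data (N : nat) : finType :=
  {M : 'I_N.+1 & {b : 'I_M.+1 & 'I_(p ^ b) * 'I_(p ^ (M - b)) * 'I_(p ^ (M - b))}}%type.

Definition hnf_of N (q : hnf_data N) : set L :=
  let: existT M (existT b (x, y, z)) := q in
  hnf (N - M) b (M - b) x%:R y%:R z%:R.

Definition hnf_stable N (q : hnf_data N) : bool :=
  let: existT M (existT b (x, y, z)) := q in
  stable delta (N - M + iota) b (M - b) z%:R.

Lemma hnf_of_inj N : injective (@hnf_of N).
Proof.
move=> [M [b [[x y] z]]] [M' [b' [[x' y'] z']]] /= /hnf_inj[] //.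
move=> [eM eb _] [ex ey ez].
have {}eM : M = M' by apply/val_inj => /=; have := ltn_ord M; have := ltn_ord M'; lia.
subst M'; have {}eb : b = b' by apply/val_inj.
by subst b'; rewrite (val_inj ex) (val_inj ey) (val_inj ez).
Qed.

Definition level N : {fset (set L)} :=
  [fset @hnf_of N q | q in [pred q | @hnf_stable N q]]%fset.

Lemma in_level N H : H \in level N ->
  [/\ subalgebra br H, finite_index H & sub_index H = (p ^ N)%N].
Proof.
case/imfsetP => -[M [b [[x y] z]]] /= st ->.
have [fi si] := hnf_cosets (N - M) b (M - b) x%:R y%:R z%:R.
split=> //; first exact/hnf_subalgebra.
rewrite si; congr (_ ^ _)%N; have := ltn_ord M; have := ltn_ord b; lia.
Qed.

Lemma level_exists H : subalgebra br H -> finite_index H ->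
  exists N, H \in level N.
Proof.
move=> aH fH; have [sH _] := aH.
have [a [b [c [x [y [z [xb yb zb eH]]]]]]] := hnf_exists sH fH.
have aM : (b + c < (a + (b + c)).+1)%N by rewrite ltnS leq_addl.
have bM : (b < (b + c).+1)%N by rewrite ltnS leq_addr.
exists (a + (b + c))%N.
have cE : (b + c - b = c)%N by rewrite addKn.
have aE : (a + (b + c) - (b + c) = a)%N by rewrite addnK.
have yb' : (y < p ^ (b + c - b))%N by rewrite cE.
have zb' : (z < p ^ (b + c - b))%N by rewrite cE.
pose q : hnf_data (a + (b + c)) := existT _ (Ordinal aM) (existT _ (Ordinal bM)
  (Ordinal xb, Ordinal yb', Ordinal zb')).
have qH : hnf_of q = H by rewrite /= cE aE.
have qs : hnf_stable q.
  by rewrite /= cE aE; apply/(hnf_subalgebra a b c x%:R y%:R z%:R); rewrite -eH.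
by apply/imfsetP; exists q.
Qed.

Lemma card_level N : #|` level N| = algebra_count delta iota N.
Proof.
rewrite card_imfset /=; last exact: hnf_of_inj.
rewrite -cardE -sum1_card /algebra_count.
under [RHS]eq_bigr => M _.
  rewrite /lattice_count big_distrr /=.
  under eq_bigr => b _.
    have bM : (b <= M)%N by rewrite -ltnS ltn_ord.
    rewrite (_ : (_ * _)%N = \sum_(xyz : 'I_(p ^ b) * 'I_(p ^ (M - b)) * 'I_(p ^ (M - b)))
       stable delta (N - M + iota) b (M - b) xyz.2%:R)%N.
      over.
    rewrite -(pair_big xpredT xpredT
      (fun (_ : 'I_(p ^ b) * 'I_(p ^ (M - b))) (z : 'I_(p ^ (M - b))) =>
      nat_of_bool (stable delta (N - M + iota) b (M - b) z%:R))) /=.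
    by rewrite sum_nat_const card_prod !card_ord -expnD subnKC.
  over.
under [RHS]eq_bigr => M _ do rewrite sig_big_dep /=.
rewrite sig_big_dep /= big_mkcond /=; apply: eq_bigr => -[M [b [[x y] z]]] _ /=.
by rewrite unfold_in /=; case: stable.
Qed.

End Subalgebras.

(** * Coordinates for the four families *)
Section FamilyCoordinates.
Variable p : nat.
Hypothesis p_pr : prime p.
Hypothesis p_odd : (2 < p)%N.
Local Notation Zp := (padic_int p).
Local Notation V := 'rV[Zp]_3.

Lemma padic_unit2 : 2%:R \is a @GRing.unit Zp.
Proof. by rewrite padic_unitE // pdvd_nat // expn1 gtnNdvd. Qed.

(** Completing the square: in the basis [e2 + b *: e3], [e3] of the ideal the
    matrix of the bracket with [e1] has a constant diagonal. Only family E needs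
    a nonzero [b]. *)
Lemma family_shear (F : lie_family p) : exists b lambda c (eps delta : Zp),
  [/\ eps \is a GRing.unit, (family_ad F).1 0 0 = 0, (family_ad F).2 0 0 = 0 &
  [/\ (family_ad F).1 0 1 = lambda - b * (p%:R ^+ c * eps),
      (family_ad F).2 0 1 = p%:R ^+ c * eps,
      (family_ad F).2 0 2%:R = lambda + b * (p%:R ^+ c * eps) &
      (family_ad F).1 0 2%:R = (delta - b ^+ 2) * (p%:R ^+ c * eps)]].
Proof.
have uN1 : (-1 : Zp) \is a GRing.unit by rewrite unitrN unitr1.
case: F => [r d|r d|r|r rho].
- exists 0, (-1), r, (-1), d; split=> //; [| |split]; rewrite !mxE /=; ring.
- have [b e] : exists b : Zp, p%:R ^+ r = 2%:R * b.
    by exists (p%:R ^+ r / 2%:R); rewrite mulrCA divrr ?mulr1 // padic_unit2.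
  exists b, (- b), 0, (-1), (b ^+ 2 + d); rewrite /= e.
  split=> //; [| |split]; rewrite !mxE /=; ring.
- exists 0, 0, 0, (-1), (p%:R ^+ r); split=> //; [| |split]; rewrite !mxE /=; ring.
- exists 0, 0, 0, (-1), (p%:R ^+ r * rho); split=> //; [| |split]; rewrite !mxE /=; ring.
Qed.

(** The discriminant is [4 * mu ^ 2 * delta], where [mu] is the factor of the
    square root of [delta] in the bracket of the unscaled algebra, so it detects
    that [delta] is nonzero. *)
Lemma family_coordinates (L : lmodType Zp) (br : L -> L -> L) (F : lie_family p) i :
  family_disc F != 0 -> lie_isomorphic br (scaled_bracket i F) ->
  exists iota (delta : Zp) (_ : coordinates br iota delta), delta != 0.
Proof.
move=> disc [f [[g fK gK] fbr]].
have [b [la [c [eps [delta [ue u0 v0 [u1 v1 v2 u2]]]]]]] := family_shear F.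
have brE w w' j : scaled_bracket i F w w' 0 j = p%:R ^+ i *
   ((w 0 0 * w' 0 1 - w 0 1 * w' 0 0) * (family_ad F).1 0 j +
    (w 0 0 * w' 0 2%:R - w 0 2%:R * w' 0 0) * (family_ad F).2 0 j).
  by rewrite /scaled_bracket /family_bracket; case: family_ad => u v /=; rewrite !mxE.
pose row3 x y z : V := \row_j (if j == 0 then x else if j == 1 then y else z).
have row3E (w w' : V) : w 0 0 = w' 0 0 -> w 0 1 = w' 0 1 -> w 0 2%:R = w' 0 2%:R -> w = w'.
  move=> h0 h1 h2; apply/rowP => -[[|[|[|//]]] hj].
  - by rewrite (_ : Ordinal hj = 0) //; exact: val_inj.
  - by rewrite (_ : Ordinal hj = 1) //; exact: val_inj.
  - by rewrite (_ : Ordinal hj = 2%:R) //; exact: val_inj.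
exists (i + c)%N, delta; unshelve eexists.
  apply: (@Coordinates p L br (i + c) delta (fun l => f l 0 0) (fun l => f l 0 1)
    (fun l => f l 0 2%:R - b * f l 0 1) (fun x y z => g (row3 x y (z + b * y)))
    _ _ _ _ _ _ _ (p%:R ^+ i * la) eps ue).
  - by move=> a u v; rewrite linearP !mxE.
  - by move=> a u v; rewrite linearP !mxE.
  - by move=> a u v; rewrite linearP !mxE; ring.
  - by move=> x y z; rewrite gK mxE.
  - by move=> x y z; rewrite gK mxE.
  - by move=> x y z; rewrite gK !mxE /=; ring.
  - move=> u v e0 e1 e2; rewrite -(fK u) -(fK v); congr g; apply: row3E => //.
    by move: e2; rewrite e1 => /addIr.
  - by move=> u v; rewrite fbr brE u0 v0; ring.
  - by move=> u v; rewrite fbr brE u1 v1 exprD; ring.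
  - by move=> u v; rewrite fbr !brE u1 v1 u2 v2 exprD; ring.
apply: contraNneq disc => d0; rewrite /family_disc; move: u1 v1 u2 v2.
case: (family_ad F) => u v /= -> -> -> ->; rewrite d0; apply/eqP; ring.
Qed.

(** The unit part of [delta] is the square of a unit as soon as it is a square
    modulo [p], by Hensel's lemma. *)
Lemma delta_class_exists (delta : Zp) : delta != 0 ->
  exists k sq, delta_class sq k delta.
Proof.
case/(padic_factor p_pr) => k [w uw ->]; exists k.
have [nsq|/(padic_sqrt p_pr p_odd uw)[u uu ->]] := pselect (nonsquare_mod w).
  by exists false; exists w.
by exists true; exists u.
Qed.

End FamilyCoordinates.

(** * Complex sequences and series *)
Section ComplexSequences.
Variable R : realType.
Local Notation K := (Cplx R).
Implicit Types (z : K).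

(** The norm of a complex number is complex valued; the estimates below are made
    with its real counterpart [normc]. *)
Definition toC (x : R) : K := real_complex R x.

Lemma normcE z : `|z| = toC (normc z).
Proof. by []. Qed.

Lemma normc_ge0 z : 0 <= normc z.
Proof. by case: z => a b; exact: sqrtr_ge0. Qed.

Lemma normc_triangle z w : normc (z + w) <= normc z + normc w.
Proof. exact: (@le_normcD R). Qed.

Lemma normc_opp z : normc (- z) = normc z.
Proof. exact: (@normcN R). Qed.

Lemma normc_exp z n : normc (z ^+ n) = normc z ^+ n.
Proof. by elim: n => [|n IH]; rewrite ?expr0 ?normc1 // !exprS normcM IH. Qed.

Lemma normc_nat n : normc (n%:R : K) = n%:R.
Proof.
have -> : (n%:R : K) = toC n%:R by exact/esym/(rmorph_nat (real_complex R)).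
by rewrite /toC /= expr0n addr0 sqrtr_sqr ger0_norm.
Qed.

Lemma toC_gt0 (e : K) : 0 < e -> exists2 d : R, 0 < d & e = toC d.
Proof. by case: e => a b; rewrite ltcE /= => /andP[/eqP -> a0]; exists a. Qed.

Lemma cvg_normcP {T} {F : set_system T} {FF : Filter F} (f : T -> K) (l : K) :
  f @ F --> l <-> forall e : R, 0 < e -> \forall t \near F, normc (l - f t) < e.
Proof.
split=> [/cvgrPdist_lt h e e0|h].
  have := h (toC e); rewrite ltcE /= eqxx e0 => /(_ isT).
  by apply: filterS => t; rewrite normcE ltcE /= => /andP[].
apply/cvgrPdist_lt => e /toC_gt0[d d0 ->]; apply: filterS (h d d0) => t td.
by rewrite normcE ltcE /= eqxx.
Qed.

Lemma cvgK_D {T} {F : set_system T} {FF : Filter F} (f g : T -> K) (a b : K) :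
  f @ F --> a -> g @ F --> b -> (fun x => f x + g x) @ F --> a + b.
Proof. exact: cvgD. Qed.

Lemma cvgK_M {T} {F : set_system T} {FF : Filter F} (f g : T -> K) (a b : K) :
  f @ F --> a -> g @ F --> b -> (fun x => f x * g x) @ F --> a * b.
Proof. exact: cvgM. Qed.

Lemma cvgK_V {T} {F : set_system T} {FF : Filter F} (f : T -> K) (a : K) :
  a != 0 -> f @ F --> a -> (fun x => (f x)^-1) @ F --> a^-1.
Proof. exact: cvgV. Qed.

Lemma cvgK_cst {T} {F : set_system T} {FF : Filter F} (a : K) : (fun _ : T => a) @ F --> a.
Proof. exact: cvg_cst. Qed.
Lemma geom_small (r M e : R) : 0 <= r -> r < 1 -> 0 < e ->
  \forall k \near \oo, r ^+ k * M < e.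
Proof.
move=> r0 r1 e0; have /cvg_expr /(cvgMr_tmp (b := M)) : `|r| < 1 by rewrite ger0_norm.
rewrite mul0r => /cvgrPdist_lt /(_ e e0); apply: filterS => k.
by rewrite sub0r normrN; apply: le_lt_trans; exact: ler_norm.
Qed.

Lemma normc_lt1_neq z : normc z < 1 -> 1 - z != 0.
Proof.
by move=> z1; rewrite subr_eq0; apply: contraTneq z1 => <-; rewrite normc1 ltxx.
Qed.
(** A contraction with a vanishing perturbation forgets its initial values. *)
Lemma perturbed_contraction (x eta : nat -> R) d (r : R) : (0 < d)%N ->
  0 <= r -> r < 1 -> (forall n, 0 <= x n) -> eta @ \oo --> (0 : R) ->
  (forall n, x (n + d)%N <= r * x n + eta n) -> x @ \oo --> (0 : R).
Proof.
move=> d0 r0 r1 x0 eta0 hx; apply/cvgrPdist_lt => e e0.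
have e1 : 0 < (1 - r) * (e / 2) by rewrite mulr_gt0 ?subr_gt0 ?divr_gt0.
have [N _ hN] := (iffLR (cvgrPdist_lt _ _)) eta0 _ e1.
have step k n : (N <= n)%N -> x (n + k * d)%N <= r ^+ k * x n + e / 2.
  move=> Nn; elim: k => [|k IH].
    by rewrite mul0n addn0 expr0 mul1r lerDl divr_ge0 // ltW.
  rewrite mulSn addnCA addnC.
  apply: le_trans (hx _) _; have : eta (n + k * d)%N <= (1 - r) * (e / 2).
    have := hN (n + k * d)%N; rewrite /= (leq_trans Nn) ?leq_addr // => /(_ isT).
    by rewrite sub0r normrN => /ltW; apply: le_trans; exact: ler_norm.
  have : r * x (n + k * d)%N <= r * (r ^+ k * x n + e / 2) by rewrite ler_wpM2l.
  rewrite exprS; lra.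
(* A bound for the first period, from which every later term is reached. *)
pose M := \sum_(j < d) x (N + j)%N.
have [k0 _ hk0] := geom_small M r0 r1 (divr_gt0 e0 (ltr0n _ 2)).
exists (N + k0 * d)%N => // n /= hn.
rewrite sub0r normrN ger0_norm //.
have -> : (n = (N + (n - N) %% d) + ((n - N) %/ d) * d)%N.
  by rewrite -addnA [(_ %% _ + _)%N]addnC -divn_eq subnKC // (leq_trans _ hn) // leq_addr.
apply: le_lt_trans (step _ _ (leq_addr _ _)) _.
have xM : x (N + (n - N) %% d)%N <= M.
  rewrite /M (bigD1 (Ordinal (ltn_pmod (n - N) d0))) //= lerDl sumr_ge0 //.
have : r ^+ ((n - N) %/ d) * x (N + (n - N) %% d)%N <= r ^+ ((n - N) %/ d) * M.
  by rewrite ler_wpM2l ?exprn_ge0.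
have : r ^+ ((n - N) %/ d) * M < e / 2.
  by apply: hk0; rewrite /= leq_divRL // leq_subRL ?(leq_trans _ hn) ?leq_addr.
lra.
Qed.

(** ** Power series with recurrent coefficients *)

Definition psum (a : nat -> K) (t : K) N : K := \sum_(n < N) a n * t ^+ n.

Lemma psumS a t N : psum a t N.+1 = psum a t N + a N * t ^+ N.
Proof. by rewrite /psum big_ord_recr. Qed.

(** The limit is the fixed point of the limiting affine map; the distance to it
    is contracted up to a vanishing error. *)
Lemma affine_recurrence_cvg (A B : nat -> K) (l q : K) d : (0 < d)%N ->
  normc q < 1 -> B @ \oo --> l -> (forall N, A (N + d)%N = B N + q * A N) ->
  A @ \oo --> l / (1 - q).
Proof.
move=> d0 q1 Bl hA.
have q1' := normc_lt1_neq q1.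
pose x n := normc (l / (1 - q) - A n).
have x0 : x @ \oo --> (0 : R).
  apply: (@perturbed_contraction x (fun n => normc (l - B n)) d (normc q)) => //.
  - exact: normc_ge0.
  - by move=> n; exact: normc_ge0.
  - apply/cvgrPdist_lt => e e0; move/cvg_normcP: Bl => /(_ e e0).
    by apply: filterS => n; rewrite sub0r normrN ger0_norm ?normc_ge0.
  move=> n; rewrite /x hA -normcM; apply: le_trans (normc_triangle _ _).
  have -> : l / (1 - q) - (B n + q * A n) = q * (l / (1 - q) - A n) + (l - B n).
    rewrite [X in X - (B n + _) = _](_ : _ = q * (l / (1 - q)) + l); first by ring.
    by field.
  exact: lexx.
apply/cvg_normcP => e e0; move/cvgrPdist_lt: x0 => /(_ e e0).
by apply: filterS => n; rewrite sub0r normrN ger0_norm ?normc_ge0.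
Qed.

(** Multiplying a generating function by [1 - k * t ^ 2] applies the recurrence to
    its coefficients. *)
Lemma psum_shift2_cvg (a b : nat -> K) (k t l : K) :
  a 0%N = b 0%N -> a 1%N = b 1%N -> (forall n, a n.+2 = b n.+2 + k * a n) ->
  normc (k * t ^+ 2) < 1 -> psum b t @ \oo --> l ->
  psum a t @ \oo --> l / (1 - k * t ^+ 2).
Proof.
move=> a0 a1 aS kt bl.
apply: (@affine_recurrence_cvg _ (fun N => psum b t (N + 2)%N) _ _ 2) => //.
  by rewrite -(cvg_shiftn 2) in bl.
move=> N; rewrite !addn2; elim: N => [|N IH].
  by rewrite /psum !big_ord_recr !big_ord0 /= a0 a1 mulr0 addr0.
by rewrite psumS IH [psum b t N.+3]psumS [psum a t N.+1]psumS aS !exprS; ring.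
Qed.

Lemma psum_eventually_cst_cvg (a : nat -> K) (c t : K) m :
  (forall n, (m <= n)%N -> a n = c) -> normc t < 1 ->
  psum a t @ \oo --> psum a t m + c * t ^+ m / (1 - t).
Proof.
move=> ac t1.
have q1' := normc_lt1_neq t1.
have -> : psum a t m + c * t ^+ m / (1 - t) =
    (psum a t m * (1 - t) + c * t ^+ m) / (1 - t) by field.
rewrite -(cvg_shiftn m).
apply: (@affine_recurrence_cvg _ (fun=> psum a t m * (1 - t) + c * t ^+ m) _ _ 1) => //.
  exact: cvg_cst.
move=> N; rewrite addn1 /=; elim: N => [|N IH].
  by rewrite add0n psumS ac //; ring.
rewrite !addSn psumS -!addSn {1}IH addSn psumS.
by rewrite !ac ?leqW ?leq_addl // !exprS; ring.
Qed.

End ComplexSequences.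

(** * Unconditional sums over graded sets *)
Section UnconditionalSums.
Variable R : realType.
Local Notation K := (Cplx R).
Variables (T : choiceType) (lev : nat -> {fset T}) (f : T -> K) (tau : K).
Hypothesis lev_disj : forall x m n, x \in lev m -> x \in lev n -> m = n.
Hypothesis f_lev : forall x n, x \in lev n -> f x = tau ^+ n.

Lemma partial_sumE (B : {fset T}) : partial_sum f B = \sum_(x <- B) f x.
Proof. by rewrite big_seq_fsetE. Qed.

Lemma lev_bounded (B : {fset T}) :
  exists M, forall x n, x \in B -> x \in lev n -> (n < M)%N.
Proof.
pose lv x := if pselect (exists n, x \in lev n) is left h then projT1 (cid h) else 0%N.
exists (\max_(x <- B) lv x).+1 => x n xB xn; rewrite ltnS.
have -> : n = lv x.
  rewrite /lv; case: pselect => [h|[]]; last by exists n.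
  by case: (cid h) => m /= xm; exact: lev_disj xm.
exact: leq_bigmax_seq.
Qed.

(** A finite partial sum only depends on the number of its elements at each
    level. *)
Lemma lev_sum (B : {fset T}) M : (forall x, (forall n, x \notin lev n) -> f x = 0) ->
  (forall x n, x \in B -> x \in lev n -> (n < M)%N) ->
  partial_sum f B = \sum_(n < M) #|` (B `&` lev n)%fset|%:R * tau ^+ n.
Proof.
move=> f0 hM; rewrite partial_sumE.
transitivity (\sum_(x <- B) \sum_(n < M) (x \in lev n)%:R * tau ^+ n : K).
  rewrite !big_seq; apply: eq_bigr => x xB.
  have [[n xn]|nx] := pselect (exists n, x \in lev n); last first.
    have nx' n : x \notin lev n by apply/negP => h; apply: nx; exists n.
    by rewrite f0 // big1 // => n _; rewrite (negbTE (nx' n)) mul0r.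
  rewrite (bigD1 (Ordinal (hM x n xB xn))) //= xn mul1r big1 ?addr0 ?(f_lev xn) //.
  move=> m mn; case: (boolP (x \in lev m)) => [xm|]; last by rewrite mul0r.
  by case/eqP: mn; apply/val_inj; exact: lev_disj xm xn.
rewrite exchange_big /=; apply: eq_bigr => n _; rewrite -big_distrl; congr (_ * _).
rewrite -natr_sum; congr (_%:R).
by rewrite -big_mkcond sum1_count -size_filter; apply/perm_size/uniq_perm;
  rewrite ?filter_uniq ?fset_uniq // => x; rewrite mem_filter !inE andbC.
Qed.

(** Grouping by levels is legitimate as soon as the grouped series converges
    absolutely: a finite family containing the first levels differs from a sum of
    complete levels by at most the tail of the series of norms. *)
Lemma unconditional_sum_cvg (S S' : K) :
  (forall x, (forall n, x \notin lev n) -> f x = 0) ->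
  psum (fun n => #|` lev n|%:R) tau @ \oo --> S ->
  psum (fun n => #|` lev n|%:R) (toC (normc tau)) @ \oo --> S' ->
  partial_sum f @ totally --> S.
Proof.
move=> f0 cS cS'; apply/cvg_normcP => [|e e0]; first exact: totally_filter.
have e2 : 0 < e / 2 by rewrite divr_gt0.
pose r := normc tau; pose ps N : R := \sum_(n < N) #|` lev n|%:R * r ^+ n.
have psE N : psum (fun n => #|` lev n|%:R) (toC r) N = toC (ps N).
  rewrite /psum /ps /toC (rmorph_sum (real_complex R)); apply: eq_bigr => n _ /=.
  by rewrite rmorphM rmorphXn rmorph_nat.
have e4 : 0 < e / 4 by rewrite divr_gt0.
move/cvg_normcP: cS => /(_ _ e2)[N1 _ h1].
move/cvg_normcP: cS' => /(_ _ e4)[N2 _ h2].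
pose N0 := maxn N1 N2; pose A0 := (\bigcup_(n <- iota 0 N0) lev n)%fset.
exists A0 => // B /= AB; have [M0 hM0] := lev_bounded B.
pose M := maxn M0 N0; rewrite (lev_sum (M := M) f0); last first.
  by move=> x n xB /(hM0 _ _ xB) h; apply: leq_trans h _; exact: leq_maxl.
have MN : (N0 <= M)%N by exact: leq_maxr.
set k := \sum_(n < M) _.
have -> : S - k = (S - psum (fun n => #|` lev n|%:R) tau M) +
    \sum_(n < M) (#|` lev n| - #|` (B `&` lev n)%fset|)%N%:R * tau ^+ n.
  have -> : \sum_(n < M) (#|` lev n| - #|` (B `&` lev n)%fset|)%N%:R * tau ^+ n =
      psum (fun n => #|` lev n|%:R) tau M - k.
    rewrite /psum /k -sumrB; apply: eq_bigr => n _.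
    by rewrite natrB ?mulrBl // fsubset_leq_card // fsubsetIr.
  by ring.
apply: le_lt_trans (normc_triangle _ _) _.
have lt1 : normc (S - psum (fun n => #|` lev n|%:R) tau M) < e / 2.
  by apply: h1; rewrite /= (leq_trans _ MN) // leq_maxl.
have tri (I : Type) (s : seq I) (F : I -> K) :
    normc (\sum_(i <- s) F i) <= \sum_(i <- s) normc (F i).
  elim/big_ind2: _ => [|x1 x2 y1 y2 h1' h2'|//]; first by rewrite normc0.
  by apply: le_trans (normc_triangle _ _) _; exact: lerD.
have lt2 : ps M - ps N0 < e / 2.
  have := h2 M; rewrite /= (leq_trans (leq_maxr _ _) MN) => /(_ isT).
  have := h2 N0; rewrite /= leq_maxr => /(_ isT); rewrite !psE.
  move=> l1 l2; have := ltrD l1 l2; rewrite -[X in _ + X]normc_opp.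
  move=> /(le_lt_trans (normc_triangle _ _)).
  have -> : S' - toC (ps N0) - (S' - toC (ps M)) = toC (ps M - ps N0).
    by rewrite /toC (rmorphB (real_complex R)) /=; ring.
  rewrite /toC /= expr0n addr0 sqrtr_sqr => h.
  by apply: le_lt_trans (ler_norm _) _; apply: lt_le_trans h _; lra.
suff : normc (\sum_(n < M)
    (#|` lev n| - #|` (B `&` lev n)%fset|)%N%:R * tau ^+ n) <= ps M - ps N0.
  by lra.
apply: le_trans (tri _ _ _) _.
have -> : ps N0 = \sum_(n < M | (n < N0)%N) #|` lev n|%:R * r ^+ n.
  by rewrite /ps (big_ord_widen _ (fun n => #|` lev n|%:R * r ^+ n) MN).
rewrite [X in _ - X]big_mkcond -sumrB; apply: ler_sum => n _.
rewrite normcM normc_nat normc_exp -/r.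
have r0 : 0 <= r by exact: normc_ge0.
case: ltnP => nN; last first.
  by rewrite subr0 ler_wpM2r ?exprn_ge0 // ler_nat leq_subr.
suff -> : (B `&` lev n)%fset = lev n by rewrite subnn mul0r subrr.
apply/eqP; rewrite eqEfsubset fsubsetIr fsubsetI fsubset_refl andbT.
apply: fsubset_trans AB; apply: (@bigfcup_sup _ _ _ (nat_of_ord n) xpredT) => //.
by rewrite mem_iota.
Qed.

(** A finite set meets finitely many levels, so that adding to it a whole level
    on which the sum has norm at least 1 contradicts the Cauchy property. *)
Lemma unconditional_sum_diverges :
  (forall N, exists2 n, (N <= n)%N & 1 <= normc (#|` lev n|%:R * tau ^+ n)) ->
  ~ cvg (partial_sum f @ totally).
Proof.
move=> big /cvg_ex[l]; move/(@cvg_normcP _ _ _ (@totally_filter T)).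
have h2 : (0 : R) < 1 / 2 by lra.
move=> /(_ _ h2)[A0 _ hA].
have [M hM] := lev_bounded A0; have [n Mn] := big M; apply/negP; rewrite -ltNge.
have dis x : x \in A0 -> x \notin lev n.
  by move=> xA; apply/negP => /(hM _ _ xA); rewrite ltnNge Mn.
have := hA (A0 `|` lev n)%fset; rewrite /= fsubsetUl => /(_ isT).
have := hA A0; rewrite /= fsubset_refl => /(_ isT).
move=> l1 l2; have := ltrD l1 l2; rewrite -[X in _ + X]normc_opp.
move=> /(le_lt_trans (normc_triangle _ _)).
have -> : l - partial_sum f A0 - (l - partial_sum f (A0 `|` lev n)%fset) =
    partial_sum f (A0 `|` lev n)%fset - partial_sum f A0 by ring.
rewrite !partial_sumE (big_fsetID _ (fun x => x \in lev n)) /=.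
have -> : \sum_(i <- [fset x in (A0 `|` lev n)%fset | x \notin lev n]%fset) f i =
    \sum_(i <- A0) f i.
  apply: eq_fbigl => x; rewrite !inE; case: (boolP (x \in A0)) => [/dis ->//|_] /=.
  by case: (x \in lev n).
have -> : \sum_(i <- [fset x in (A0 `|` lev n)%fset | x \in lev n]%fset) f i =
    #|` lev n|%:R * tau ^+ n.
  transitivity (\sum_(i <- lev n) tau ^+ n); last first.
    by rewrite big_const_seq count_predT iter_addr_0 mulr_natl.
  apply: eq_fbig => [x|x]; rewrite !inE.
    by rewrite andbC; case: (x \in lev n); rewrite ?orbT.
  by case/andP => _; exact: f_lev.
rewrite addrK => /lt_le_trans; apply; lra.
Qed.

End UnconditionalSums.

(** * Complex powers *)
Section ComplexPowers.
Variable R : realType.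
Local Notation K := (Cplx R).
Implicit Types (x : R) (s : K).

Lemma cpowD x s s' : x != 0 -> cpow x (s + s') = cpow x s * cpow x s'.
Proof.
move=> x0; rewrite /cpow (negbTE x0); case: s s' => [a b] [c d] /=.
rewrite !mulrDl expRD cosD sinD; simpc.
by congr (_ +i* _)%C; ring.
Qed.

Lemma cpow0 x : x != 0 -> cpow x 0 = 1 :> K.
Proof.
by move=> x0; rewrite /cpow (negbTE x0) /= !mul0r expR0 cos0 sin0 mulr1 mulr0.
Qed.

Lemma cpow_neq0 x s : x != 0 -> cpow x s != 0.
Proof.
move=> x0; apply: contra_neq (oner_neq0 K) => h.
by rewrite -(cpow0 x0) -[X in cpow _ X](subrr s) cpowD // h mul0r.
Qed.

Lemma cpowMn x s n : x != 0 -> cpow x (s * n%:R) = cpow x s ^+ n.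
Proof.
move=> x0; elim: n => [|n IH]; first by rewrite mulr0 cpow0.
by rewrite mulrS mulrDr mulr1 cpowD // IH exprS.
Qed.

Lemma cpow_exp x s n : 0 < x -> cpow (x ^+ n) s = cpow x s ^+ n.
Proof.
move=> x0; rewrite -cpowMn ?gt_eqF // /cpow expf_eq0 !gt_eqF // andbF.
rewrite lnXn // -mulr_natr; case: s => a b.
have -> : (n%:R : K) = toC n%:R by exact/esym/(rmorph_nat (real_complex R)).
rewrite /toC /=; simpc.
by congr (expR _ * cos _ +i* (expR _ * sin _))%C; ring.
Qed.

Lemma cpow1 x : 0 < x -> cpow x 1 = toC x.
Proof.
move=> x0; rewrite /cpow gt_eqF //= mul1r mul0r cos0 sin0 mulr1 mulr0.
by rewrite lnK.
Qed.

Lemma cpowV x s : 0 < x -> cpow (x^-1) s = cpow x (- s).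
Proof.
move=> x0; rewrite /cpow invr_eq0 gt_eqF // lnV ?posrE //.
by case: s => a b /=; rewrite !mulrN !mulNr.
Qed.

Lemma normc_cpow x s : x != 0 -> normc (cpow x s) = expR (complex.Re s * ln x).
Proof.
move=> x0; rewrite /cpow (negbTE x0) /= !exprMn -mulrDr cos2Dsin2 mulr1.
by rewrite sqrtr_sqr ger0_norm // expR_ge0.
Qed.

End ComplexPowers.

Section PrimePowers.
Variables (R : realType) (p : nat).
Hypothesis p_pr : prime p.
Local Notation K := (Cplx R).
Local Notation T s := (cpow (p%:R : R) (- s)).
Implicit Types s : K.

Lemma p_gt0 : 0 < (p%:R : R).
Proof. by rewrite ltr0n prime_gt0. Qed.

Lemma p_neq0 : (p%:R : R) != 0.
Proof. by rewrite gt_eqF // p_gt0. Qed.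

Lemma pK_neq0 : (p%:R : K) != 0.
Proof. by rewrite pnatr_eq0 -lt0n prime_gt0. Qed.

(** Translating [s] by [n] multiplies [p ^ (- s)] by [p ^ n]: all the functions
    in the theorem become rational functions of one variable. *)
Lemma T_subn s n : T (s - n%:R) = p%:R ^+ n * T s.
Proof.
rewrite opprB cpowD ?p_neq0 // -[n%:R]mul1r cpowMn ?p_neq0 // cpow1 ?p_gt0 //.
congr (_ ^+ _ * _); exact: (rmorph_nat (real_complex R)).
Qed.

Lemma T_double s n : T (n%:R * s) = T s ^+ n.
Proof. by rewrite -cpowMn ?p_neq0 //; congr cpow; ring. Qed.

Lemma T_mul s n : cpow p%:R ((2%:R - s) * n%:R) = (p%:R ^+ 2 * T s) ^+ n :> K.
Proof. by rewrite cpowMn ?p_neq0 // -T_subn opprB. Qed.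

Lemma normc_T s : normc (T s) = expR (- (complex.Re s * ln p%:R)).
Proof. by rewrite normc_cpow ?p_neq0 //; case: s => a b /=; rewrite mulNr. Qed.

Lemma ln_p_gt0 : 0 < ln (p%:R : R).
Proof. by rewrite ln_gt0 // ltr1n prime_gt1. Qed.

Lemma normc_T_lt s (n : nat) : n%:R < complex.Re s -> normc (p%:R ^+ n * T s) < 1.
Proof.
move=> hs; rewrite -T_subn normc_T -[X in _ < X](expR0) ltr_expR oppr_lt0.
by rewrite mulr_gt0 ?ln_p_gt0 // raddfB /= -(rmorph_nat (real_complex R)) subr_gt0.
Qed.

End PrimePowers.

(** * The zeta function as a power series *)
Section ZetaSeries.
Variables (R : realType) (p : nat).
Hypothesis p_pr : prime p.
Hypothesis p_odd : (2 < p)%N.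
Local Notation K := (Cplx R).
Local Notation Zp := (padic_int p).
Variables (sq : bool) (k : nat).

(** One rational function must represent Igusa's zeta function for all [delta] in
    a class, so the counts are expressed by the class alone. *)
Definition rootnum j : nat := if (j <= k)%N then (p ^ j./2)%N else root_limit p sq k.

Lemma roots_rootnum (delta : Zp) j : delta_class sq k delta -> roots delta j = rootnum j.
Proof.
move=> dk; rewrite /rootnum; case: leqP => jk; last exact: roots_large.
have [w ->] : exists w : Zp, delta = p%:R ^+ k * w.
  by move: dk; rewrite /delta_class; case: sq => [[u _ ->]|[w [_ _ ->]]]; eexists.
exact: roots_small.
Qed.

Variable iota : nat.

Definition primnum n : nat :=
  (if n == 0 then 1 else if n <= iota then p ^ n + p ^ n.-1
   else p ^ iota * rootnum (n - iota))%N.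

Local Notation m := (iota + k.+1)%N.

(** The first two terms of the numerator sum the series with coefficients
    [primnum], which are constant from the index [iota + k.+1] on; the third one
    accounts for the remaining terms of the recurrence for
    [prim_algebra_count]. *)
Definition zeta_value (t : K) : K :=
  (psum (fun n => (primnum n)%:R) (p%:R * t) m +
   (p ^ iota * root_limit p sq k)%:R * (p%:R * t) ^+ m / (1 - p%:R * t) +
   t * (1 + p%:R * t) / (1 - t)) / (1 - p%:R ^+ 2 * t ^+ 2) ^+ 2.

(** Both recurrences, for lattices and for exponents of the image in the
    quotient, have step 2 and ratio [p ^ 2], whence the square of
    [1 - p ^ 2 * t ^ 2] in the denominator. *)
Lemma zeta_series_cvg (delta : Zp) (t : K) : delta_class sq k delta ->
  normc (p%:R * t) < 1 ->
  psum (fun N => (algebra_count delta iota N)%:R) t @ \oo --> zeta_value t.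
Proof.
move=> dk pt1; have p1 : (1 : R) <= p%:R by rewrite ler1n prime_gt0.
have t1 : normc t < 1.
  apply: le_lt_trans pt1; rewrite normcM normc_nat ler_peMl //; exact: normc_ge0.
have pt2 : normc (p%:R ^+ 2 * t ^+ 2) < 1.
  by rewrite -exprMn normc_exp exprn_ilt1 ?normc_ge0.
have -> : zeta_value t = zeta_value t * (1 - p%:R ^+ 2 * t ^+ 2) / (1 - p%:R ^+ 2 * t ^+ 2).
  by rewrite mulfK // normc_lt1_neq.
apply: (psum_shift2_cvg (b := fun N => (prim_algebra_count delta iota N)%:R)) => //.
- by rewrite algebra_count0.
- by rewrite algebra_count1.
- by move=> n; rewrite algebra_countSS // natrD natrM natrX.
rewrite /zeta_value expr2 invfM mulrA mulfVK; last exact: normc_lt1_neq.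
(* The constant part of the recurrence for [prim_algebra_count]. *)
pose h n : nat := if n is n'.+1 then (if n' is _.+1 then 1 + p else 1)%N else 0%N.
have primE n : prim_count delta iota n = primnum n.
  by rewrite /prim_count /primnum; case: ifP => // _; case: ifP => // _;
     rewrite (roots_rootnum _ dk).
apply: (psum_shift2_cvg (b := fun N => (h N + p ^ N * prim_count delta iota N)%N%:R)) => //.
- by rewrite prim_algebra_count0.
- by rewrite prim_algebra_count1.
- by move=> n; rewrite prim_algebra_countSS // natrD (natrM _ (p ^ 2)) natrX.
have -> : psum (fun N => (h N + p ^ N * prim_count delta iota N)%N%:R) t =
    (fun N => psum (fun n => (primnum n)%:R) (p%:R * t) N + psum (fun n => (h n)%:R) t N).
  apply/funext => N; rewrite /psum -big_split; apply: eq_bigr => n _ /=.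
  by rewrite natrD natrM natrX primE exprMn; ring.
apply: cvgK_D.
  apply: psum_eventually_cst_cvg => // n mn; congr (_%:R).
  rewrite /primnum gtn_eqF; last by apply: leq_trans mn; rewrite addnS.
  rewrite leqNgt; have -> : (iota < n)%N by apply: leq_trans mn; rewrite addnS ltnS leq_addr.
  rewrite /= /rootnum leqNgt; have -> // : (k < n - iota)%N.
  by rewrite ltn_subRL; apply: leq_trans mn; rewrite addnS.
have -> : t * (1 + p%:R * t) / (1 - t) = psum (fun n => (h n)%:R) t 2 +
    (1 + p)%:R * t ^+ 2 / (1 - t).
  by rewrite /psum !big_ord_recr big_ord0 /= natrD; field; exact: normc_lt1_neq.
by apply: psum_eventually_cst_cvg => // -[|[|n]].
Qed.

Section Zeta.
Variables (L : lmodType Zp) (br : L -> L -> L) (delta : Zp).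
Variable C : coordinates br iota delta.
Hypothesis dk : delta_class sq k delta.
Implicit Type s : K.
Local Notation T s := (cpow (p%:R : R) (- s)).

Lemma level_disj H N N' : H \in level C N -> H \in level C N' -> N = N'.
Proof.
move=> /(in_level p_pr)[_ _ e] /(in_level p_pr)[_ _]; rewrite e => /eqP.
by rewrite eqn_exp2l ?prime_gt1 // => /eqP.
Qed.

Lemma zeta_term_level s H N : H \in level C N -> zeta_term br s H = T s ^+ N.
Proof.
move=> /(in_level p_pr)[aH fH iH]; rewrite /zeta_term patchE mem_set //.
by rewrite iH natrX cpow_exp ?p_gt0.
Qed.

Lemma zeta_term_out s H : (forall N, H \notin level C N) -> zeta_term br s H = 0.
Proof.
move=> hH; rewrite /zeta_term patchE memNset // => -[aH fH].
by have [N] := level_exists p_pr C aH fH; rewrite (negbTE (hH N)).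
Qed.

Lemma level_card_fun : (fun N => #|` level C N|%:R : K) =
  (fun N => (algebra_count delta iota N)%:R).
Proof. by apply/funext => N; rewrite card_level. Qed.

Lemma zeta_partial_sum_cvg s : 1 < complex.Re s ->
  partial_sum (zeta_term br s) @ totally --> zeta_value (T s).
Proof.
move=> s1; have hs : normc (p%:R * T s) < 1.
  by have := @normc_T_lt R p p_pr s 1 s1; rewrite expr1.
apply: (@unconditional_sum_cvg R _ (level C) _ (T s) level_disj (@zeta_term_level s)
  _ (zeta_value (toC (normc (T s)))) (@zeta_term_out s)).
  by rewrite level_card_fun; exact: zeta_series_cvg.
rewrite level_card_fun; apply: zeta_series_cvg => //.
by move: hs; rewrite !normcM /toC /= expr0n addr0 sqrtr_sqr ger0_norm ?normc_ge0.
Qed.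

Lemma zeta_cvg_right s : 1 < complex.Re s -> zeta_cvg br s.
Proof. by move=> s1; apply/cvg_ex; eexists; exact: zeta_partial_sum_cvg. Qed.

Lemma zetaE s : 1 < complex.Re s -> zeta br s = zeta_value (T s).
Proof.
move=> s1; have TF := @totally_filter (set L).
by apply: (cvg_lim (@norm_hausdorff _ _)); exact: zeta_partial_sum_cvg.
Qed.

Lemma algebra_count_ge N : (p ^ N.*2 <= algebra_count delta iota N.*2)%N.
Proof.
elim: N => [|N IH]; first by rewrite algebra_count0 prim_algebra_count0.
rewrite doubleS algebra_countSS // -add2n expnD; apply: leq_trans (leq_addl _ _).
by rewrite leq_mul2l IH orbT.
Qed.

(** There are at least [p ^ (2 * N)] subalgebras of index [p ^ (2 * N)], so on the
    left of 1 the levels of even exponent do not tend to 0. *)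
Lemma zeta_diverges s : complex.Re s < 1 -> ~ zeta_cvg br s.
Proof.
move=> s1; apply: (@unconditional_sum_diverges R _ (level C) _ (T s) level_disj
  (@zeta_term_level s)) => N; exists N.*2; first by rewrite -addnn leq_addr.
rewrite card_level // normcM normc_nat normc_exp.
have p1 : 1 <= p%:R * normc (T s).
  rewrite normc_T // -{1}(lnK (x := p%:R)) ?posrE ?p_gt0 // -expRD -{1}(expR0 R) ler_expR.
  have := ln_p_gt0 R p_pr; nra.
apply: (@le_trans _ _ ((p%:R * normc (T s)) ^+ N.*2)).
  exact: exprn_ege1.
rewrite exprMn ler_wpM2r ?exprn_ge0 ?normc_ge0 //.
by rewrite -natrX ler_nat algebra_count_ge.
Qed.

Lemma zeta_abscissa1 : zeta_abscissa br (1 : R).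
Proof. by move=> s; split; [exact: zeta_cvg_right|exact: zeta_diverges]. Qed.

End Zeta.
End ZetaSeries.

(** * Haar measure of congruence sets *)
Section HaarMeasure.
Variables (R : realType) (p : nat).
Hypothesis p_pr : prime p.
Local Notation Zp := (padic_int p).
Local Notation V := 'rV[Zp]_2.
Variable mu : {measure set (borel_space p 2) -> \bar R}.
Hypothesis mu_haar : normalised_haar mu.

Definition residue_box j (a : Zp * Zp) : set (borel_space p 2) :=
  [set x : V | pdvd j (x 0 0 - a.1) /\ pdvd j (x 0 1 - a.2)].

Lemma pdvd_nbhs j (x : Zp) : nbhs x [set y : Zp | pdvd j (y - x)].
Proof.
apply: open_nbhs_nbhs; split; last by rewrite /= subrr pdvdn0.
move=> y /= yx; exists j => z zy; rewrite -(subrK y z) -addrA pdvdD //.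
case: j {yx} zy => [|j] zy; first exact: pdvd0.
rewrite (pdvd_le (leqnSn _)) // pdvdS //.
by have -> : (z - y) j.+1 = z j.+1 - y j.+1 by []; rewrite zy subrr.
Qed.

Lemma residue_box_measurable j a : measurable (residue_box j a).
Proof.
apply: sub_sigma_algebra; rewrite openE => x [x0 x1].
exists (fun i k => [set y | pdvd j (y - x i k)]) => [i k|y /= yx].
  exact: pdvd_nbhs.
by split; [rewrite -(subrK (x 0 0) (y 0 0))|rewrite -(subrK (x 0 1) (y 0 1))];
   rewrite -addrA pdvdD.
Qed.

Lemma residue_box_translate j a :
  mu (residue_box j a) = mu (residue_box j (0, 0)).
Proof.
have [_ inv] := mu_haar; pose v : V := \row_i (if i == 0 then a.1 else a.2).
rewrite -(inv v (residue_box j (0, 0))); last exact: residue_box_measurable.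
congr (mu _); apply/seteqP; split=> [x [x0 x1]|_ [x [x0 x1] <-]].
  exists (x - v); last by rewrite addrC subrK.
  by split; rewrite /= subr0 !mxE.
rewrite /= !subr0 in x0 x1.
by split; rewrite /= !mxE /= addrC addrK.
Qed.

(** The residue boxes modulo [p ^ j] are disjoint translates of each other and
    cover the plane, so that a congruence set is measured by counting. *)
Lemma haar_residues j (P : pred ('I_(p ^ j) * 'I_(p ^ j))) :
  let A := [set x : borel_space p 2 |
     exists2 i, P i & residue_box j ((i.1)%:R, (i.2)%:R) x] in
  measurable A /\ mu A = (#|P|%:R / (p ^ j * p ^ j)%:R)%:E.
Proof.
have boxT (Q : pred ('I_(p ^ j) * 'I_(p ^ j))) :
    [set x | exists2 i, Q i & residue_box j ((i.1)%:R, (i.2)%:R) x] =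
    \big[setU/set0]_(i <- [fset i | i in Q]%fset) residue_box j ((i.1)%:R, (i.2)%:R).
  rewrite -bigcup_seq; apply/seteqP; split=> [x [i iQ xi]|x [i /= iQ xi]].
    by exists i => //=; rewrite !inE.
  by exists i => //; move: iQ; rewrite !inE.
have mc : mu (residue_box j (0, 0)) \is a fin_num.
  rewrite ge0_fin_numE //; apply: (@le_lt_trans _ _ (mu setT)).
    by apply: le_measure; rewrite ?inE //; exact: residue_box_measurable.
  by have [-> _] := mu_haar; rewrite ltry.
pose c := fine (mu (residue_box j (0, 0))).
have boxM (Q : pred ('I_(p ^ j) * 'I_(p ^ j))) :
    mu [set x | exists2 i, Q i & residue_box j ((i.1)%:R, (i.2)%:R) x] = (#|Q|%:R * c)%:E.
  rewrite boxT measure_fbigsetU.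
  - rewrite (eq_bigr (fun=> c%:E)); last first.
      by move=> i _; apply: etrans (residue_box_translate j _) _; rewrite fineK.
    rewrite sumEFin big_const_seq count_predT iter_addr_0 mulr_natl.
    by rewrite card_imfset //= -cardE.
  - by move=> i _; exact: residue_box_measurable.
  move=> [i1 i2] [j1 j2] _ _ [x [/= [a1 a2] [b1 b2]]].
  have same (y : Zp) (i k : 'I_(p ^ j)) : pdvd j (y - i%:R) -> pdvd j (y - k%:R) -> i = k.
    move=> yi yk; apply/val_inj/(pdvd_nat_inj p_pr (ltn_ord _) (ltn_ord _)).
    have -> : i%:R - k%:R = (y - k%:R) - (y - i%:R) by ring.
    by rewrite pdvdD ?pdvdN.
  by rewrite (same _ _ _ a1 b1) (same _ _ _ a2 b2).
move=> A; split.
  rewrite /A boxT; apply: bigsetU_measurable => i _; exact: residue_box_measurable.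
rewrite boxM; congr (_ * _)%:E; have [mu1 _] := mu_haar.
have := boxM predT; rewrite (_ : [set x | _] = setT); last first.
  apply/seteqP; split=> // x _.
  by exists (Ordinal (pres_lt p_pr j (x 0 0)), Ordinal (pres_lt p_pr j (x 0 1))) => //;
     split; exact: presP.
have q0 : ((p ^ j * p ^ j)%:R : R) != 0.
  by rewrite pnatr_eq0 -lt0n muln_gt0 !pexp_gt0.
by rewrite mu1 card_prod !card_ord => -[h]; apply: (mulfI q0); rewrite -h divff.
Qed.

Definition form_level (delta : Zp) j : set (borel_space p 2) :=
  [set x | pdvd j (binary_form delta x)].

Lemma form_levelP (delta : Zp) j : measurable (form_level delta j) /\
  mu (form_level delta j) = ((solutions delta j)%:R / (p ^ j * p ^ j)%:R)%:E.
Proof.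
pose P (i : 'I_(p ^ j) * 'I_(p ^ j)) : bool :=
  pdvd j ((i.1)%:R ^+ 2 - delta * (i.2)%:R ^+ 2).
have [mA muA] := haar_residues P.
have e : form_level delta j = [set x : borel_space p 2 |
     exists2 i, P i & residue_box j ((i.1)%:R, (i.2)%:R) x].
  have cong (x : V) (a : Zp * Zp) : residue_box j a x ->
     pdvd j (binary_form delta x) = pdvd j (a.1 ^+ 2 - delta * a.2 ^+ 2).
    move=> [x0 x1]; apply: pdvd_congr; rewrite /binary_form.
    have -> : x 0 0 ^+ 2 - delta * x 0 1 ^+ 2 - (a.1 ^+ 2 - delta * a.2 ^+ 2) =
      (x 0 0 + a.1) * (x 0 0 - a.1) + - delta * (x 0 1 + a.2) * (x 0 1 - a.2) by ring.
    by rewrite pdvdD ?pdvdMl.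
  apply/seteqP; split=> [x /= xj|x [i Pi /cong xi]]; last by rewrite /form_level /= xi.
  have xb : residue_box j ((pres j (x 0 0))%:R, (pres j (x 0 1))%:R) x.
    by split; exact: presP.
  exists (Ordinal (pres_lt p_pr j (x 0 0)), Ordinal (pres_lt p_pr j (x 0 1))) => //.
  by rewrite /P /= -(cong _ _ xb).
rewrite e; split=> //; rewrite muA; congr (_%:R / _)%:E.
rewrite -sum1_card /solutions /cnt exchange_big /= pair_big /= big_mkcond.
by apply: eq_bigr => i _; rewrite unfold_in /P; case: pdvd.
Qed.

End HaarMeasure.

(** * Integrals of functions of a valuation *)
Section LevelIntegral.
Context {d : measure_display} {T : measurableType d} {R : realType}.
Variable mu : {measure set T -> \bar R}.
Hypothesis mu_fin : (mu setT < +oo)%E.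
Variables (A : nat -> set T) (w : nat -> R) (h : nat -> R) (f : T -> R).
Hypothesis A_meas : forall j, measurable (A j).
Hypothesis A_mu : forall j, mu (A j) = (w j)%:E.
Hypothesis A0 : A 0%N = setT.
Hypothesis A_decr : forall j, A j.+1 `<=` A j.
Hypothesis h_le1 : forall j, `|h j| <= 1.
Hypothesis f_level : forall j x, A j x -> ~ A j.+1 x -> f x = h j.
Hypothesis f_inf : forall x, (forall j, A j x) -> f x = 0.

Let C j := A j `\` A j.+1.

Lemma A_decr_le i j : (i <= j)%N -> A j `<=` A i.
Proof.
move=> /subnK <-; elim: (j - i)%N => [//|k IH] x; rewrite addSn => /A_decr.
exact: IH.
Qed.

Lemma level_cases x : (exists j, C j x) \/ (forall j, A j x).
Proof.
have [h1|/existsNP[j nj]] := pselect (forall j, A j x); first by right.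
left; elim: j nj => [|j IH] nj; first by case: nj; rewrite A0.
by have [Aj|/IH//] := pselect (A j x); exists j.
Qed.

Lemma level_meas j : measurable (C j).
Proof. exact: measurableD. Qed.

Lemma level_mu j : mu (C j) = (w j - w j.+1)%:E.
Proof.
have e : A j `&` A j.+1 = A j.+1 by apply/setIidr/A_decr.
transitivity (mu (A j) - mu (A j `&` A j.+1))%E; last by rewrite e !A_mu.
by apply: measureD => //; apply: le_lt_trans mu_fin; apply: le_measure; rewrite ?inE.
Qed.

Lemma level_disjoint : trivIset setT C.
Proof.
move=> i j _ _ [x [[Ai nAi] [Aj nAj]]].
by have [ij|ji|//] := ltngtP i j; [case: nAi; exact: (A_decr_le ij Aj)
                                  |case: nAj; exact: (A_decr_le ji Ai)].
Qed.

Lemma level_fun_meas : measurable_fun setT f.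
Proof.
move=> _ B mB; rewrite setTI.
have -> : f @^-1` B = \bigcup_j (if `[< B (h j) >] then C j else set0) `|`
    (if `[< B 0 >] then \bigcap_j A j else set0).
  apply/seteqP; split=> [x Bfx|x [[j _]|]].
  - have [[j Cj]|Ax] := level_cases x; last first.
      by right; rewrite asboolT //; rewrite -(f_inf Ax).
    by left; exists j => //; rewrite asboolT // -(f_level Cj.1 Cj.2).
  - by case: asboolP => // Bh [Aj nAj]; rewrite /preimage /= (f_level Aj nAj).
  - by case: asboolP => // B0 Ax; rewrite /preimage /= f_inf // => j; exact: Ax.
apply: measurableU.
  by apply: bigcupT_measurable => j; case: ifP => _ //; exact: level_meas.
by case: ifP => _ //; exact: bigcapT_measurable.
Qed.

Lemma level_fun_le1 x : `|f x| <= 1.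
Proof.
have [[j [Aj nAj]]|Ax] := level_cases x; last by rewrite f_inf // normr0.
by rewrite (f_level Aj nAj).
Qed.

Lemma level_fun_integrable : mu.-integrable setT (EFin \o f).
Proof.
apply: measurable_bounded_integrable => //; first exact: level_fun_meas.
exists 1; split=> // M M1 x _ /=; exact: le_trans (level_fun_le1 x) (ltW M1).
Qed.

(** A function of the level, vanishing where all levels meet, is integrated by
    summing over the pairwise disjoint differences of consecutive levels. *)
Lemma level_integral l : (fun N => \sum_(j < N) h j * (w j - w j.+1)) @ \oo --> (l : R) ->
  Rintegral mu setT f = l.
Proof.
move=> cl; pose D := \bigcup_j C j.
have mD : measurable D by apply: bigcupT_measurable => j; exact: level_meas.
have intD : mu.-integrable D (EFin \o f).
  by apply: integrableS level_fun_integrable.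
have -> : Rintegral mu setT f = Rintegral mu D f.
  rewrite [RHS]Rintegral_mkcond; congr Rintegral; apply/funext => x; rewrite patchE.
  case: ifPn => // /negP xD; rewrite f_inf // => j; have [[i Ci]|] := level_cases x; last by [].
  by case: xD; rewrite inE; exists i.
rewrite /Rintegral (integral_bigcup level_disjoint level_meas intD).
have level_int i : (\int[mu]_(x in C i) (EFin \o f) x = (h i * (w i - w i.+1))%:E)%E.
  rewrite EFinM -level_mu -integral_cst; last exact: level_meas.
  by apply: eq_integral => x; rewrite inE => -[Ai nAi]; rewrite /= (f_level Ai nAi).
rewrite (eq_eseriesr (fun i _ => level_int i)).
suff -> : (\sum_(0 <= i <oo) (h i * (w i - w i.+1))%:E)%E = l%:E by [].
apply: cvg_lim => //; apply: cvg_EFin; first by near=> N; rewrite sumEFin.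
have -> // : fine \o (fun n => \sum_(0 <= i < n) (h i * (w i - w i.+1))%:E)%E =
  (fun N => \sum_(j < N) h j * (w j - w j.+1)).
by apply/funext => N /=; rewrite sumEFin /= big_mkord.
Unshelve. all: by end_near.
Qed.

End LevelIntegral.

(** * Igusa's local zeta function of the binary form *)
Section Igusa.
Variables (R : realType) (p : nat).
Hypothesis p_pr : prime p.
Hypothesis p_odd : (2 < p)%N.
Local Notation K := (Cplx R).
Local Notation Zp := (padic_int p).
Variable mu : {measure set (borel_space p 2) -> \bar R}.
Hypothesis mu_haar : normalised_haar mu.
Variables (sq : bool) (k : nat).
Local Notation T s := (cpow (p%:R : R) (- s)).
Local Notation q := (p%:R : K).

(** Here [g] is the generating function of the numbers of square roots of [delta]
    modulo the positive powers of [p], taken at [t / p]. *)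
Definition igusa_value (t : K) : K :=
  let g := psum (fun j => (rootnum p sq k j)%:R) (t / q) k.+1 +
    (root_limit p sq k)%:R * (t / q) ^+ k.+1 / (1 - t / q) - 1 in
  (t * (1 - q ^- 2) - (1 - t) * (1 - q^-1) * g) / (t * (1 - q ^- 2 * t ^+ 2)).

Definition level_mass (delta : Zp) j : K := (solutions delta j)%:R / q ^+ j.*2.

Lemma level_mass0 delta : level_mass delta 0 = 1.
Proof. by rewrite /level_mass solutions0 expr0 divr1. Qed.

Lemma level_mass1 delta : level_mass delta 1 =
  (1 - q^-1) * ((roots delta 1)%:R * q ^- 1) + q ^- 2.
Proof.
rewrite /level_mass solutionsS // !expn0 expn1 natrD natrM natrB ?prime_gt0 //.
by field; exact: pK_neq0.
Qed.

Lemma level_massSS delta j : level_mass delta j.+2 =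
  (1 - q^-1) * ((roots delta j.+2)%:R * q ^- j.+2) + q ^- 2 * level_mass delta j.
Proof.
rewrite /level_mass solutionsS // natrD !natrM natrB ?leq_exp2l ?prime_gt1 //.
rewrite !natrX doubleS -!muln2 !exprS exprM expr2.
have := expf_neq0 j (pK_neq0 R p_pr); move: (q ^+ j) => x x0.
by field; rewrite x0 pK_neq0.
Qed.

Lemma normc_t_div t : normc t < 1 -> normc (t / q) < 1.
Proof.
move=> t1; rewrite normcM normcV normc_nat; apply: le_lt_trans t1.
by rewrite ler_piMr ?normc_ge0 // invf_le1 ?ler1n ?prime_gt0 // ltr0n prime_gt0.
Qed.

Lemma level_mass_psum_cvg (delta : Zp) (t : K) : delta_class sq k delta ->
  normc t < 1 ->
  psum (level_mass delta) t @ \oo -->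
    ((1 - q^-1) * (psum (fun j => (rootnum p sq k j)%:R) (t / q) k.+1 +
      (root_limit p sq k)%:R * (t / q) ^+ k.+1 / (1 - t / q)) + (q^-1 + q ^- 2 * t)) /
    (1 - q ^- 2 * t ^+ 2).
Proof.
move=> dk t1; have tq1 := normc_t_div t1.
(* The corrections to the recurrence for [level_mass] at the indices 0 and 1. *)
pose e n : K := if n is n'.+1 then (if n' is _.+1 then 0 else q ^- 2) else q^-1.
pose b n := (1 - q^-1) * ((roots delta n)%:R * q ^- n) + e n.
apply: (psum_shift2_cvg (b := b)).
- by rewrite level_mass0 /b roots0 expr0 invr1 mulr1 mulr1 subrK.
- by rewrite level_mass1.
- by move=> n; rewrite level_massSS /b addr0.
- have -> : q ^- 2 * t ^+ 2 = (t / q) ^+ 2 by rewrite exprMn exprVn mulrC.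
  by rewrite normc_exp exprn_ilt1 ?normc_ge0.
have -> : psum b t = (fun N => (1 - q^-1) * psum (fun j => (rootnum p sq k j)%:R) (t / q) N +
    psum e t N).
  apply/funext => N; rewrite /psum big_distrr -big_split; apply: eq_bigr => n _ /=.
  by rewrite /b -(roots_rootnum p_pr p_odd _ dk) exprMn exprVn; ring.
apply: cvgK_D.
  apply: cvgMl_tmp; apply: psum_eventually_cst_cvg => // n kn.
  by rewrite /rootnum leqNgt kn.
have -> : q^-1 + q ^- 2 * t = psum e t 2 + 0 * t ^+ 2 / (1 - t).
  by rewrite /psum !big_ord_recr big_ord0 /= !mul0r addr0 add0r expr0 mulr1 expr1.
by apply: psum_eventually_cst_cvg => // -[|[|n]].
Qed.

(** Summation by parts from the series of the masses of the levels. *)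
Lemma level_mass_series_cvg (delta : Zp) (t : K) : delta_class sq k delta ->
  t != 0 -> normc t < 1 ->
  psum (fun j => level_mass delta j - level_mass delta j.+1) t @ \oo --> igusa_value t.
Proof.
move=> dk t0 t1; have cW := level_mass_psum_cvg dk t1.
have n1 := normc_lt1_neq (normc_t_div t1).
have n2 : 1 - q ^- 2 * t ^+ 2 != 0.
  have -> : q ^- 2 * t ^+ 2 = (t / q) ^+ 2 by rewrite exprMn exprVn mulrC.
  by apply: normc_lt1_neq; rewrite normc_exp exprn_ilt1 ?normc_ge0 // normc_t_div.
set W := (X in _ --> X) in cW.
have -> : igusa_value t = t^-1 * (t * W - (W - 1)).
  rewrite /igusa_value /W; set G := psum _ _ _; set H := _ / (1 - t / q).
  move: n2 t0 (pK_neq0 R p_pr); move: G H (q) => G H r n2 t0 r0.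
  have r2 : r ^+ 2 - t ^+ 2 != 0.
    have -> : r ^+ 2 - t ^+ 2 = r ^+ 2 * (1 - r ^- 2 * t ^+ 2) by field.
    by rewrite mulf_neq0 // expf_neq0.
  by field; rewrite r0 r2 t0.
rewrite (_ : psum _ t =
    (fun N => t^-1 * (t * psum (level_mass delta) t N -
                      (psum (level_mass delta) t N.+1 - 1)))); last first.
  apply/funext => N; apply: (mulfI t0); rewrite mulVKf // /psum big_ord_recl.
  rewrite level_mass0 expr0 mulr1 [1 + _]addrC addrK !big_distrr -sumrB.
  by apply: eq_bigr => n _; rewrite /= /bump add1n exprS; ring.
apply: cvgMl_tmp; apply: cvgB; first exact: cvgMl_tmp.
apply: (cvgK_D (f := fun N => psum (level_mass delta) t N.+1) (g := fun=> - 1)).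
  by rewrite (cvg_shiftS (psum (level_mass delta) t)).
exact: cvg_cst.
Qed.

(** ** The integral as a power series *)

Lemma cvg_Re_Im (u : nat -> K) (l : K) : u @ \oo --> l ->
  ((fun n => complex.Re (u n)) @ \oo --> complex.Re l) /\
  ((fun n => complex.Im (u n)) @ \oo --> complex.Im l).
Proof.
move/cvg_normcP => h; split; apply/cvgrPdist_lt => e /h; apply: filterS => n;
  apply: le_lt_trans; rewrite -raddfB /=; case: (l - u n) => a b /=.
  by rewrite -[X in X <= _]sqrtr_sqr ler_wsqrtr // lerDl sqr_ge0.
by rewrite -[X in X <= _]sqrtr_sqr ler_wsqrtr // lerDr sqr_ge0.
Qed.

Lemma normc_Re_Im (z : K) : `|complex.Re z| <= normc z /\ `|complex.Im z| <= normc z.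
Proof.
by case: z => a b /=; split; rewrite -[X in X <= _]sqrtr_sqr ler_wsqrtr ?lerDl ?lerDr ?sqr_ge0.
Qed.

Let wR (delta : Zp) j : R := (solutions delta j)%:R / (p ^ j * p ^ j)%:R.

Lemma level_massE delta j : level_mass delta j = toC (wR delta j).
Proof.
rewrite /level_mass /wR /toC fmorph_div !rmorph_nat; congr (_ / _).
by rewrite -expnD addnn natrX.
Qed.

Lemma igusaE (delta : Zp) s : delta_class sq k delta -> 0 < complex.Re s ->
  igusa mu (binary_form delta) s = igusa_value (T s).
Proof.
move=> dk s0; have t1 : normc (T s) < 1.
  by have := @normc_T_lt R p p_pr s 0 s0; rewrite mul1r.
have t0 : T s != 0 by apply: cpow_neq0; exact: p_neq0.
have [cR cI] := cvg_Re_Im (level_mass_series_cvg dk t0 t1).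
pose A j := form_level delta j : set (borel_space p 2).
have mA j : measurable (A j) := (form_levelP p_pr mu_haar delta j).1.
have muA j : mu (A j) = (wR delta j)%:E := (form_levelP p_pr mu_haar delta j).2.
have A0 : A 0%N = setT by apply/seteqP; split=> // x _; exact: pdvd0.
have dA j : A j.+1 `<=` A j by move=> x; apply: pdvd_le.
have muT : (mu setT < +oo)%E by have [-> _] := mu_haar; rewrite ltry.
pose F (x : borel_space p 2) := cpow (padic_abs R (binary_form delta x)) s.
have F_level j x : A j x -> ~ A j.+1 x -> F x = T s ^+ j.
  rewrite /A /form_level /F /=; move: (binary_form delta x) => y yj /negP nyj.
  have [y0|/(padic_factor p_pr)[i [u uu e]]] := eqVneq y 0.
    by rewrite y0 pdvdn0 in nyj.
  rewrite e pdvd_expu // in yj; rewrite e pdvd_expu // -ltnNge ltnS in nyj.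
  have ij : i = j by apply/eqP; rewrite eqn_leq nyj yj.
  rewrite e ij padic_abs_exp // cpowV ?exprn_gt0 ?p_gt0 //.
  by rewrite cpow_exp ?p_gt0.
have F_inf x : (forall j, A j x) -> F x = 0.
  by move=> Ax; rewrite /F (pdvd_eq0 p_pr Ax) padic_abs0 /cpow eqxx.
have Tj j : normc (T s ^+ j) <= 1 by rewrite normc_exp exprn_ile1 ?normc_ge0 // ltW.
have sumE (r : K -> R) : (forall a z, r (z * toC a) = r z * a) ->
    {morph r : x y / x + y} -> r 0 = 0 ->
    (fun N => r (psum (fun j => level_mass delta j - level_mass delta j.+1) (T s) N)) =
    (fun N => \sum_(j < N) r (T s ^+ j) * (wR delta j - wR delta j.+1)).
  move=> rM rD r0; apply/funext => N; rewrite /psum (big_morph _ rD r0).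
  by apply: eq_bigr => j _; rewrite !level_massE -rmorphB mulrC rM.
rewrite sumE in cR; first last.
- by [].
- by move=> x y; rewrite raddfD.
- by move=> a [x y] /=; rewrite mulr0 subr0.
rewrite sumE in cI; first last.
- by [].
- by move=> x y; rewrite raddfD.
- by move=> a [x y] /=; rewrite mulr0 add0r mulrC.
have ReT j : `|complex.Re (T s ^+ j)| <= 1.
  by apply: le_trans (Tj j); have [] := normc_Re_Im (T s ^+ j).
have ImT j : `|complex.Im (T s ^+ j)| <= 1.
  by apply: le_trans (Tj j); have [] := normc_Re_Im (T s ^+ j).
have eR : Rintegral mu setT (fun x => complex.Re (F x)) = complex.Re (igusa_value (T s)).
  apply: (level_integral muT mA muA A0 dA ReT _ _ cR).
    by move=> j x Aj nAj; rewrite (F_level j).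
  by move=> x Ax; rewrite F_inf.
have eI : Rintegral mu setT (fun x => complex.Im (F x)) = complex.Im (igusa_value (T s)).
  apply: (level_integral muT mA muA A0 dA ImT _ _ cI).
    by move=> j x Aj nAj; rewrite (F_level j).
  by move=> x Ax; rewrite F_inf.
have -> : igusa_value (T s) =
    (complex.Re (igusa_value (T s)) +i* complex.Im (igusa_value (T s)))%C.
  by case: (igusa_value _).
by rewrite -eR -eI.
Qed.

End Igusa.

(** * Rational functions, the identity and the pole *)
Section RationalFunctions.
Variables (R : realType) (p : nat).
Hypothesis p_pr : prime p.
Variables (sq : bool) (k iota : nat).
Local Notation K := (Cplx R).
Local Notation q := (p%:R : K).
Local Notation m := (iota + k.+1)%N.
Local Notation rn := (rootnum p sq k).
Local Notation pn := (primnum p sq k iota).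
Local Notation rl := (root_limit p sq k).
Implicit Types t : K.

Lemma qm1_neq0 : q - 1 != 0.
Proof. by rewrite subr_eq0 pnatr_eq1 gtn_eqF // prime_gt1. Qed.

(** ** The functional identity *)

Lemma psum_primnum_head u n : (n <= iota)%N ->
  (1 - q * u) * psum (fun j => (pn j)%:R) u n.+1 =
  (1 - q * u) + (1 + q^-1) * (q * u - (q * u) ^+ n.+1).
Proof.
have q0 := pK_neq0 R p_pr; elim: n => [|n IH] h.
  by rewrite /psum big_ord1 /primnum /= expr0 expr1; ring.
rewrite psumS mulrDr IH 1?ltnW // /primnum /= h natrD !natrX !exprS exprMn.
by move: (u ^+ n) (q ^+ n) => x y; field.
Qed.

(** Beyond [iota] the points of the projective line are counted by the square
    roots of [delta]: this is where the two zeta functions share their data. *)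
Lemma psum_primnum_tail u j :
  psum (fun i => (pn i)%:R) u (iota + j.+1) =
  psum (fun i => (pn i)%:R) u iota.+1 +
  (q * u) ^+ iota * (psum (fun i => (rn i)%:R) u j.+1 - 1).
Proof.
elim: j => [|j IH].
  by rewrite addn1 [psum _ u 1]/psum big_ord1 /rootnum /= mulr1 subrr mulr0 addr0.
rewrite addnS psumS IH [psum _ u j.+2]psumS /primnum addnS /= ltnNge leq_addr /=.
have -> : ((iota + j).+1 - iota = j.+1)%N by rewrite -addnS addKn.
rewrite natrM natrX exprMn -addnS exprD; ring.
Qed.

(** Once the geometric sum of the first [iota] terms is evaluated, both sides are
    rational in [t], in the power [y], and in the values [G] and [H] of the common
    generating function. *)
Lemma zeta_igusa_identity t : t != 0 -> 1 - t != 0 -> 1 - q * t != 0 ->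
  1 - q ^+ 2 * t != 0 -> 1 - q ^+ 2 * t ^+ 2 != 0 ->
  zeta_value p sq k iota t =
  (1 - t)^-1 * (1 - q * t)^-1 * (1 - q ^+ 2 * t)^-1 -
  igusa_value p sq k (q ^+ 2 * t) * (1 - q ^+ 2 * t ^+ 2)^-1 *
  (1 - q ^+ 2 * t)^-1 * (q ^+ 2 * t) ^+ (iota + 1) * (1 - q^-1)^-1.
Proof.
move=> t0 h1 h2 h3 h4; have q0 := pK_neq0 R p_pr; have q1 := qm1_neq0.
rewrite /zeta_value /igusa_value.
have -> : q ^+ 2 * t / q = q * t by field.
rewrite psum_primnum_tail natrM natrX.
have := psum_primnum_head (q * t) (leqnn iota).
have -> : q * (q * t) = q ^+ 2 * t by ring.
move=> /(canRL (mulKf h3)) ->.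
have -> : (q * t) ^+ m = (q * t) ^+ iota * (q * t) ^+ k.+1 by rewrite exprD.
have -> : q ^+ iota * rl%:R * ((q * t) ^+ iota * (q * t) ^+ k.+1) / (1 - q * t) =
  (q ^+ 2 * t) ^+ iota * (rl%:R * (q * t) ^+ k.+1 / (1 - q * t)).
  have -> : (q ^+ 2 * t) ^+ iota = q ^+ iota * (q * t) ^+ iota.
    by rewrite -exprMn; congr (_ ^+ _); ring.
  by ring.
have -> : q ^- 2 * (q ^+ 2 * t) ^+ 2 = q ^+ 2 * t ^+ 2 by field.
rewrite addn1 ![(q ^+ 2 * t) ^+ iota.+1]exprS.
move: ((q ^+ 2 * t) ^+ iota) (psum _ _ _) (rl%:R * _ / _) => y G H.
by field; rewrite q0 q1 h3 exprMn h4 t0 h2 h1.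
Qed.

(** ** Numerators and denominators *)

Definition psum_poly (c : nat -> nat) (r : K) n : {poly K} :=
  \sum_(j < n) (c j)%:R *: (r *: 'X) ^+ j.

Lemma psum_polyE c r n t : (psum_poly c r n).[t] = psum (fun j => (c j)%:R) (r * t) n.
Proof.
rewrite /psum_poly horner_sum; apply: eq_bigr => j _.
by rewrite hornerZ horner_exp hornerZ hornerX.
Qed.

(** One denominator for all classes: when [root_limit] vanishes, the factor
    [1 - q *: 'X] cancels. The extra factor ['X] in the second denominator never
    vanishes at a power of [p]. *)
Definition zeta_ratfun : ratfun R :=
  ((1 - 'X) * (1 - q *: 'X) * psum_poly pn q m +
   (1 - 'X) * ((p ^ iota * rl)%:R *: (q *: 'X) ^+ m) +
   'X * (1 + q *: 'X) * (1 - q *: 'X),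
   (1 - 'X) * (1 - q *: 'X) * (1 - q ^+ 2 *: 'X ^+ 2) ^+ 2).

Definition igusa_ratfun : ratfun R :=
  ((1 - q ^- 2) *: 'X * (1 - q^-1 *: 'X) -
   (1 - q^-1) *: (1 - 'X) * ((psum_poly rn q^-1 k.+1 - 1) * (1 - q^-1 *: 'X) +
     rl%:R *: (q^-1 *: 'X) ^+ k.+1),
   'X * (1 - q^-1 *: 'X) * (1 - q ^- 2 *: 'X ^+ 2)).

Let horner_simp := (hornerD, hornerN, hornerM, hornerZ, hornerX, hornerC, horner_exp).

Lemma zeta_den t : zeta_ratfun.2.[t] = (1 - t) * (1 - q * t) * (1 - q ^+ 2 * t ^+ 2) ^+ 2.
Proof. by rewrite /= !horner_simp. Qed.

Lemma igusa_den t : igusa_ratfun.2.[t] = t * (1 - q^-1 * t) * (1 - q ^- 2 * t ^+ 2).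
Proof. by rewrite /= !horner_simp. Qed.

Lemma zeta_ratfunE t : zeta_ratfun.2.[t] != 0 ->
  zeta_ratfun.1.[t] / zeta_ratfun.2.[t] = zeta_value p sq k iota t.
Proof.
rewrite zeta_den /= !horner_simp psum_polyE /zeta_value.
move: (psum _ _ _) ((p ^ iota * rl)%N%:R : K) ((q * t) ^+ m) => G r x.
rewrite mulf_eq0 mulf_eq0 expf_eq0 /= !negb_or => /andP[/andP[h1 h2] h3].
by field; rewrite h1 h2 exprMn h3.
Qed.

Lemma igusa_ratfunE t : igusa_ratfun.2.[t] != 0 ->
  igusa_ratfun.1.[t] / igusa_ratfun.2.[t] = igusa_value p sq k t.
Proof.
have q0 := pK_neq0 R p_pr.
rewrite igusa_den /= !horner_simp psum_polyE /igusa_value [t / q]mulrC.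
move: (psum _ _ _) (rl%:R : K) ((q^-1 * t) ^+ k.+1) => G r x.
rewrite !mulf_eq0 /= !negb_or => /andP[/andP[t0 h2] h3].
have h2' : q - t != 0.
  have -> : q - t = q * (1 - q^-1 * t) by field.
  by rewrite mulf_neq0.
have h3' : q ^+ 2 - t ^+ 2 != 0.
  have -> : q ^+ 2 - t ^+ 2 = q ^+ 2 * (1 - q ^- 2 * t ^+ 2) by field.
  by rewrite mulf_neq0 // expf_neq0.
by field; rewrite ?q0 ?t0 ?h2' ?h3'.
Qed.

(** ** The pole *)

Lemma cvg_horner {T} {F : set_system T} {FF : Filter F} (P : {poly K}) (f : T -> K) (l : K) :
  f @ F --> l -> (fun x => P.[f x]) @ F --> P.[l].
Proof.
move=> fl; elim/poly_ind: P => [|P c IH].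
  rewrite horner0 (_ : (fun x => _) = (fun=> 0)); first exact: cvgK_cst.
  by apply/funext => x; rewrite horner0.
rewrite hornerMXaddC (_ : (fun x => _) = (fun x => P.[f x] * f x + c)); last first.
  by apply/funext => x; rewrite hornerMXaddC.
apply: (cvgK_D (f := fun x => P.[f x] * f x) (g := fun=> c)); last exact: cvgK_cst.
exact: (cvgK_M IH fl).
Qed.

Lemma derive_approx (f : R -> R) (l e : R) : is_derive (0 : R) 1 f l -> 0 < e ->
  \forall h \near (0 : R), `|f h - f 0 - l * h| <= e * `|h|.
Proof.
move=> [df fl] e0; move: df; rewrite /derivable => /cvg_ex[l' cl].
have ll : l' = l by rewrite -fl /derive; apply/esym/cvg_lim.
subst l'; move/cvgrPdist_le : cl => /(_ e e0).
rewrite near_withinE; apply: filterS => h hh.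
have [->|h0] := eqVneq h 0; first by rewrite subrr mulr0 subr0 normr0 mulr0.
have := hh h0; rewrite /= [_%:A]mulr1 addr0 => {}hh.
have -> : f h - f 0 - l * h = - (h * (l - h^-1 *: (f h - f 0))).
  rewrite mulrBr /GRing.scale /= mulVKf //; ring.
by rewrite normrN normrM mulrC ler_wpM2r.
Qed.

Local Notation L := (ln (p%:R : R)).
Local Notation T s := (cpow (p%:R : R) (- s)).

Lemma approx_exp_cos_sin (e : R) : 0 < e -> exists2 d : R, 0 < d &
  forall h : R, `|h| < d -> [/\ `|expR h - 1 - h| <= e * `|h|,
     `|cos h - 1| <= e * `|h| & `|sin h - h| <= e * `|h|].
Proof.
move=> e0.
have hE : is_derive (0 : R) 1 expR 1.
  by rewrite -[X in is_derive _ _ _ X](@expR0 R); exact: is_derive_expR.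
have hC : is_derive (0 : R) 1 cos 0.
  by rewrite -[X in is_derive _ _ _ X]oppr0 -[X in - X](@sin0 R); exact: is_derive_cos.
have hS : is_derive (0 : R) 1 sin 1.
  by rewrite -[X in is_derive _ _ _ X](@cos0 R); exact: is_derive_sin.
have : \forall h \near (0 : R), [/\ `|expR h - 1 - h| <= e * `|h|,
     `|cos h - 1| <= e * `|h| & `|sin h - h| <= e * `|h|].
  apply: filterS3 (derive_approx hE e0) (derive_approx hC e0) (derive_approx hS e0) => h.
  by rewrite expR0 cos0 sin0 !mul1r mul0r !subr0.
move=> /nbhs_ballP[d /= d0 hd]; exists d => // h hd'; apply: hd.
by rewrite /ball /= sub0r normrN.
Qed.

Lemma normc_le_Re_Im (z : K) : normc z <= `|complex.Re z| + `|complex.Im z|.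
Proof.
case: z => a b /=; rewrite -[X in _ <= X]ger0_norm ?addr_ge0 // -sqrtr_sqr ler_wsqrtr //.
rewrite sqrrD !real_normK ?num_real // lerD2r lerDl.
by rewrite mulrn_wge0 // mulr_ge0.
Qed.

(** First-order expansion of the exponential of [- (a + i b)], from the expansions
    of its real ingredients. *)
Lemma cexp_approx (e : R) (a b : R) : 0 < e -> e <= 1 -> `|a| <= e ->
  `|expR (- a) - 1 + a| <= e * `|a| -> `|cos b - 1| <= e * `|b| -> `|sin b - b| <= e * `|b| ->
  normc ((a - 1 + expR (- a) * cos b) +i* (b - expR (- a) * sin b))%C <=
  8%:R * e * (`|a| + `|b|).
Proof.
move=> e0 e1 ae hE hC hS; apply: le_trans (normc_le_Re_Im _) _ => /=.
have E1 : `|expR (- a) - 1| <= 2%:R * `|a|.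
  have -> : expR (- a) - 1 = (expR (- a) - 1 + a) - a by ring.
  apply: le_trans (ler_normB _ _) _; have := normr_ge0 a; nra.
have E2 : expR (- a) <= 3%:R.
  have := ler_norm (expR (- a) - 1); have := normr_ge0 a; nra.
have S1 : `|sin b| <= 2%:R * `|b|.
  have -> : sin b = (sin b - b) + b by ring.
  apply: le_trans (ler_normD _ _) _; have := normr_ge0 b; nra.
have hr : `|a - 1 + expR (- a) * cos b| <= e * `|a| + 3%:R * (e * `|b|).
  have -> : a - 1 + expR (- a) * cos b = (expR (- a) - 1 + a) + expR (- a) * (cos b - 1).
    by ring.
  apply: le_trans (ler_normD _ _) _; rewrite lerD // normrM.
  by apply: ler_pM => //; rewrite ger0_norm ?expR_ge0.
have hi : `|b - expR (- a) * sin b| <= e * `|b| + 2%:R * `|a| * (2%:R * `|b|).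
  have -> : b - expR (- a) * sin b = - (sin b - b) - (expR (- a) - 1) * sin b by ring.
  apply: le_trans (ler_normB _ _) _; rewrite normrN lerD // normrM.
  exact: ler_pM.
have ab : `|a| * `|b| <= e * `|b| by rewrite ler_wpM2r.
have := normr_ge0 a; have := normr_ge0 b; nra.
Qed.

(** The factor [1 - p ^ (1 - s)] has a simple zero at [s = 1], with derivative
    [ln p]. *)
Lemma cpow_derivative :
  (fun s : K => (1 - q * T s) / (s - 1)) @ (1 : K)^' --> toC L.
Proof.
apply/cvg_normcP => e e0; have L0 := ln_p_gt0 R p_pr.
(* This makes [16 * e' * L] smaller than [e], and [e'] at most 1. *)
pose e' := e / (e + 16%:R * L).
have D0 : 0 < e + 16%:R * L by lra.
have e'0 : 0 < e' by rewrite divr_gt0.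
have e'E : e' * (e + 16%:R * L) = e by rewrite divfK // gt_eqF.
have e'1 : e' <= 1 by nra.
have [d d0 hd] := approx_exp_cos_sin e'0.
have md0 : 0 < Num.min d e' / L by rewrite divr_gt0 // lt_min d0.
have cid : (fun s : K => s) @ (1 : K)^' --> (1 : K) by exact: cvg_within.
move/cvg_normcP : cid => /(_ _ md0) near1.
near=> s.
have s1 : s - 1 != 0 by rewrite subr_eq0; near: s; exact: nbhs_dnbhs_neq.
have : normc (1 - s) < Num.min d e' / L by near: s.
rewrite -normc_opp opprB ltr_pdivlMr // lt_min => /andP[zd ze].
have -> : q * T s = T (s - 1) by have := T_subn p_pr s 1; rewrite expr1 => <-.
move: (s - 1) s1 zd ze => z z0 zd ze.
have -> : toC L - (1 - T z) / z = (toC L * z - 1 + T z) / z by field.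
have nz : 0 < normc z.
  by rewrite lt_neqAle normc_ge0 andbT eq_sym; apply: contra z0 => /eqP/eq0_normc ->.
rewrite normcM normcV ltr_pdivrMr //.
case: z z0 zd ze nz => x y _ zd ze nz; have [xz yz] := normc_Re_Im (x +i* y)%C.
rewrite [complex.Re _]/= in xz; rewrite [complex.Im _]/= in yz.
move: nz zd ze xz yz; move: (normc (x +i* y)%C) => nz nz0 zd ze xz yz.
have aE : `|x * L| <= nz * L by rewrite normrM (gtr0_norm L0) ler_wpM2r // ltW.
have bE : `|y * L| <= nz * L by rewrite normrM (gtr0_norm L0) ler_wpM2r // ltW.
have -> : toC L * (x +i* y)%C - 1 + T (x +i* y)%C =
  ((x * L - 1 + expR (- (x * L)) * cos (y * L)) +i* (y * L - expR (- (x * L)) * sin (y * L)))%C.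
  rewrite /cpow (negbTE (p_neq0 R p_pr)) /toC /=; simpc.
  by rewrite cosN sinN mulrN; congr (_ +i* _)%C; ring.
have [|hE _ _] := hd (- (x * L)); first by rewrite normrN (le_lt_trans aE).
have [|_ hC hS] := hd (y * L); first by rewrite (le_lt_trans bE).
rewrite opprK normrN in hE.
apply: le_lt_trans (cexp_approx e'0 e'1 _ hE hC hS) _.
  by apply: le_trans aE _; exact: ltW.
apply: (@le_lt_trans _ _ (8%:R * e' * (nz * L + nz * L))).
  by rewrite ler_wpM2l ?lerD // mulr_ge0 // ltW.
have -> : 8%:R * e' * (nz * L + nz * L) = (e' * (e + 16%:R * L) - e' * e) * nz by ring.
by rewrite e'E ltr_pM2r // ltrBlDr ltrDl mulr_gt0.
Unshelve. all: by end_near.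
Qed.

Lemma cvg_qT : (fun s : K => q * T s) @ (1 : K)^' --> (1 : K).
Proof.
have cid : (fun s : K => s - 1) @ (1 : K)^' --> (0 : K).
  rewrite -[X in _ --> X](subrr (1 : K)); apply: (cvgK_D (g := fun=> - 1)); last exact: cvgK_cst.
  exact: cvg_within.
have := cvgK_D (@cvgK_cst R _ (1 : K)^' _ 1)
  (cvgK_M (@cvgK_cst R _ (1 : K)^' _ (-1)) (cvgK_M cid cpow_derivative)).
rewrite mul0r mulr0 addr0 => cu; rewrite (_ : (fun s : K => q * T s) =
  (fun s : K => 1 + -1 * ((s - 1) * ((1 - q * T s) / (s - 1))))); first exact: cu.
apply/funext => s.
have [->|s1] := eqVneq s 1.
  have := @T_subn R p p_pr 1 1; rewrite subrr oppr0 cpow0 ?p_neq0 // expr1 => <-.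
  by rewrite subrr mul0r mulr0 addr0.
by rewrite mulrC [(s - 1) * _]mulrC divfK ?subr_eq0 //; ring.
Qed.

Lemma cvg_T : (fun s : K => T s) @ (1 : K)^' --> q^-1.
Proof.
have := cvgK_M (@cvgK_cst R _ (1 : K)^' _ q^-1) cvg_qT; rewrite mulr1 => cu.
rewrite (_ : (fun s : K => T s) = (fun s : K => q^-1 * (q * T s))); first exact: cu.
by apply/funext => s; rewrite mulKf // pK_neq0.
Qed.

(** In [1 - p ^ 2 * t ^ 2], only the factor [1 - p * t] vanishes at [t = 1 / p];
    the other one, [1 + p * t], tends to 2. *)
Lemma cvg_pole_power (P : {poly K}) n :
  (fun s : K => P.[T s] / ((1 - T s) * (1 + q * T s) ^+ 2) * ((s - 1) / (1 - q * T s)) ^+ n)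
    @ (1 : K)^' --> P.[q^-1] / ((1 - q^-1) * (1 + 1) ^+ 2) * (toC L)^-1 ^+ n.
Proof.
have L0 : toC L != 0 by rewrite /toC fmorph_eq0 gt_eqF // ln_p_gt0.
have q1 : 1 - q^-1 != 0.
  by rewrite subr_eq0 eq_sym invr_eq1 -subr_eq0 qm1_neq0.
apply: cvgK_M.
  apply: cvgK_M; first exact/cvg_horner/cvg_T.
  apply: (cvgK_V (f := fun s : K => (1 - T s) * (1 + q * T s) ^+ 2)).
    by rewrite mulf_neq0 // expf_neq0 // -mulr2n pnatr_eq0.
  rewrite (_ : (fun s : K => _) =
      (fun s : K => ((1 - 'X) * (1 + q *: 'X) ^+ 2 : {poly K}).[T s])); last first.
    by apply/funext => s; rewrite !horner_simp.
  have -> : (1 - q^-1) * (1 + 1) ^+ 2 = ((1 - 'X) * (1 + q *: 'X) ^+ 2 : {poly K}).[q^-1].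
    by rewrite !horner_simp divff // pK_neq0.
  exact/cvg_horner/cvg_T.
have -> : (toC L)^-1 ^+ n = ('X^n : {poly K}).[(toC L)^-1] by rewrite hornerXn.
rewrite (_ : (fun s : K => _) =
    (fun s : K => ('X^n : {poly K}).[((1 - q * T s) / (s - 1))^-1])); last first.
  by apply/funext => s; rewrite hornerXn invf_div.
by apply: cvg_horner; apply: cvgK_V => //; exact: cpow_derivative.
Qed.

(** The denominator has a triple zero. The numerator takes there the value
    [(1 - 1 / p) * p ^ iota * root_limit], which is nonzero exactly in the case of
    a triple pole; otherwise one factor [1 - p * t] cancels, and the value of the
    remaining numerator is positive. *)
Lemma zeta_pole : pole_of_order (ratfun_at p zeta_ratfun) 1
  (if sq && ~~ odd k then 3%N else 2%N).
Proof.
have q0 := pK_neq0 R p_pr; have L0 : toC L != 0 by rewrite /toC fmorph_eq0 gt_eqF // ln_p_gt0.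
have q1 : 1 - q^-1 != 0.
  by rewrite subr_eq0 eq_sym invr_eq1 -subr_eq0 qm1_neq0.
have d4 : (1 - q^-1) * (1 + 1) ^+ 2 != 0.
  by rewrite mulf_neq0 // expf_neq0 // -mulr2n pnatr_eq0.
have den (s : K) : zeta_ratfun.2.[T s] =
    (1 - T s) * (1 + q * T s) ^+ 2 * (1 - q * T s) ^+ 3 by rewrite zeta_den; ring.
have [sqk|sqk] := boolP (sq && ~~ odd k).
  exists (zeta_ratfun.1.[q^-1] / ((1 - q^-1) * (1 + 1) ^+ 2) * (toC L)^-1 ^+ 3).
    rewrite !mulf_neq0 ?invr_eq0 ?expf_neq0 ?invr_eq0 //.
    rewrite /= !horner_simp divff // subrr !mulr0 mul0r add0r addr0 expr1n mulr1.
    rewrite mulf_neq0 // pnatr_eq0 -lt0n muln_gt0 pexp_gt0 // /root_limit sqk.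
    by rewrite muln_gt0 pexp_gt0.
  rewrite (_ : (fun s : K => _) = (fun s : K =>
    zeta_ratfun.1.[T s] / ((1 - T s) * (1 + q * T s) ^+ 2) * ((s - 1) / (1 - q * T s)) ^+ 3)).
    exact: cvg_pole_power.
  apply/funext => s; rewrite /ratfun_at den invfM exprMn exprVn; move: (_.[_]) => N.
  by move: (_^-1) (_^-1) => u v; ring.
pose N1 : {poly K} := (1 - 'X) * psum_poly pn q m + 'X * (1 + q *: 'X).
exists (N1.[q^-1] / ((1 - q^-1) * (1 + 1) ^+ 2) * (toC L)^-1 ^+ 2).
  rewrite !mulf_neq0 ?invr_eq0 ?expf_neq0 ?invr_eq0 //.
  rewrite !horner_simp psum_polyE divff //.
  have -> : psum (fun j => (pn j)%:R) 1 m = (\sum_(j < m) pn j)%N%:R :> K.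
    by rewrite natr_sum; apply: eq_bigr => j _; rewrite expr1n mulr1.
  move: (\sum_(j < m) _)%N => n.
  have -> : (1 - q^-1) * n%:R + q^-1 * (1 + 1) = ((p - 1) * n + 2)%N%:R / q :> K.
    by rewrite natrD natrM natrB ?prime_gt0 //; field.
  by rewrite mulf_neq0 ?invr_eq0 // pnatr_eq0 addn2.
rewrite (_ : (fun s : K => _) = (fun s : K =>
  N1.[T s] / ((1 - T s) * (1 + q * T s) ^+ 2) * ((s - 1) / (1 - q * T s)) ^+ 2)).
  exact: cvg_pole_power.
apply/funext => s.
have num : zeta_ratfun.1.[T s] = (1 - q * T s) * N1.[T s].
  by rewrite /= !horner_simp /root_limit (negbTE sqk) muln0 mul0r mulr0; ring.
rewrite /ratfun_at den num invfM exprMn exprVn; move: (N1.[_]) (_ * (1 + _) ^+ 2)^-1 => N A.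
have -> : (1 - q * T s) ^- 2 = (1 - q * T s) * (1 - q * T s) ^- 3.
  have [->|u0] := eqVneq (1 - q * T s) 0; first by rewrite !expr0n /= invr0 mul0r.
  by move: (1 - q * T s) u0 => u u0; field.
by ring.
Qed.

End RationalFunctions.

(** * The theorem *)
Theorem proposition4p1 (R : realType) (p : nat) (p_prime : prime p)
    (p_ge3 : (3 <= p)%N)
    (mu : {measure set (borel_space p 2) -> \bar R})
    (mu_haar : normalised_haar mu)
    (L : lmodType (padic_int p)) (br : L -> L -> L)
    (br_lie : lie_bracket br) (L_rank : free_of_rank L 3)
    (L_soluble : soluble br)
    (F : lie_family p) (F_ok : family_ok F) (F_disc : family_disc F != 0)
    (i : nat) (L_F : lie_isomorphic br (scaled_bracket i F)) :
  exists (k iota : nat) (square : bool) (WL WZ : ratfun R),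
    [/\ continuation p (fun s => zeta br s) 1 WL,
        forall delta : padic_int p, delta_class square k delta ->
          continuation p (igusa mu (binary_form delta)) 0 WZ,
        forall s : Cplx R,
          ratfun_regular p WL s -> ratfun_regular p WZ (s - 2%:R) ->
          zeta_regular p s -> zeta_regular p (s - 1) ->
          zeta_regular p (s - 2%:R) -> zeta_regular p (2%:R * s - 2%:R) ->
          ratfun_at p WL s =
          zeta_abelian3 p s -
          ratfun_at p WZ (s - 2%:R) * zetap p (2%:R * s - 2%:R) *
          zetap p (s - 2%:R) * cpow p%:R ((2%:R - s) * (iota + 1)%:R) *
          (1 - p%:R^-1)^-1,
        zeta_abscissa br (1 : R) &
        pole_of_order (ratfun_at p WL) 1
          (if square && ~~ odd k then 3%N else 2%N)].
Proof.
have p_pr := p_prime; have p_odd := p_ge3.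
have [iota [delta [C delta0]]] := family_coordinates p_pr p_odd F_disc L_F.
have [k [sq dk]] := delta_class_exists p_prime p_odd delta0.
have denZ (s : Cplx R) : 1 < complex.Re s ->
    ratfun_regular p (zeta_ratfun R p sq k iota) s.
  move=> s1; have h1 : normc (p%:R * cpow (p%:R : R) (- s)) < 1.
    by have := @normc_T_lt R p p_pr s 1 s1; rewrite expr1.
  have h0 : normc (cpow (p%:R : R) (- s)) < 1.
    have := @normc_T_lt R p p_pr s 0 (lt_trans ltr01 s1); by rewrite mul1r.
  rewrite /ratfun_regular zeta_den; apply: mulf_neq0.
    by rewrite mulf_neq0 ?normc_lt1_neq.
  by rewrite expf_neq0 // -exprMn normc_lt1_neq // normc_exp exprn_ilt1 ?normc_ge0.
have denI (s : Cplx R) : 0 < complex.Re s ->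
    ratfun_regular p (igusa_ratfun R p sq k) s.
  move=> s0; have h0 : normc (cpow (p%:R : R) (- s)) < 1.
    have := @normc_T_lt R p p_pr s 0 s0; by rewrite mul1r.
  have h1 := normc_t_div p_pr h0.
  rewrite /ratfun_regular igusa_den !mulf_neq0 //.
  - exact/cpow_neq0/p_neq0.
  - by rewrite mulrC normc_lt1_neq.
  have -> (t : Cplx R) : p%:R ^- 2 * t ^+ 2 = (t / p%:R) ^+ 2 by rewrite exprMn exprVn mulrC.
  by rewrite normc_lt1_neq // normc_exp exprn_ilt1 ?normc_ge0.
exists k, iota, sq, (zeta_ratfun R p sq k iota), (igusa_ratfun R p sq k).
split.
- split.
    have /denZ : 1 < complex.Re (2%:R : Cplx R) by rewrite /= ltrDl.
    by apply: contraNneq => ->; rewrite horner0.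
  move=> s s1; have r := denZ s s1; split=> //.
  by rewrite (zetaE p_pr p_odd C dk s1) /ratfun_at zeta_ratfunE.
- move=> d' dk'; split.
    have /denI : 0 < complex.Re (1 : Cplx R) by rewrite /=.
    by apply: contraNneq => ->; rewrite horner0.
  move=> s s0; have r := denI s s0; split=> //.
  by rewrite (igusaE p_pr p_odd mu_haar dk' s0) /ratfun_at igusa_ratfunE.
- move=> s rL rZ; rewrite /zeta_regular.
  rewrite /ratfun_at zeta_ratfunE // igusa_ratfunE //.
  rewrite /zeta_abelian3 /zetap.
  have := T_subn p_pr s 1; rewrite expr1 => ->.
  rewrite T_mul // (T_subn p_pr (2%:R * s)) T_subn // T_double //.
  have ne (x : Cplx R) : (x != 1) = (1 - x != 0) by rewrite subr_eq0 eq_sym.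
  rewrite !ne => h0 h1 h2 h4.
  by apply: zeta_igusa_identity => //; apply/cpow_neq0/p_neq0.
- exact: (zeta_abscissa1 p_pr p_odd C dk).
- exact: (zeta_pole R p_pr sq k iota).
Qed.
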